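(* The problem $\textsc{Comp-Sub}(\mathcal{PM})$ can be solved in polynomial time on hole-free graphs.
   Context: All graphs are finite, simple and undirected. $\textsc{Comp-Sub}(\mathcal{PM})$ is the decision problem: given a graph $G=(V,E)$, can $V$ be partitioned into $V_1,V_2$ such that $G[V_1]$ is isomorphic to the complement of $G[V_2]$ and the set of edges of $G$ between $V_1$ and $V_2$ is a perfect matching (every vertex is incident to exactly one such edge)? In this paper a hole is an induced cycle on $5$ or more vertices; a graph is hole-free if it contains no hole as an induced subgraph. *)

(* Defs.v *)
From HB Require Import structures.
From mathcomp Require Import all_boot.

Set Implicit Arguments.
Unset Strict Implicit.
Unset Printing Implicit Defensive.

Record sgraph (T : finType) := SGraph {
  adj :> rel T;
  adj_sym : symmetric adj;
  adj_irr : irreflexive adj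
}.

Definition compl_rel (T : finType) (G : sgraph T) : rel T :=
  fun x y => (x != y) && ~~ adj G x y.

Lemma compl_rel_sym (T : finType) (G : sgraph T) : symmetric (compl_rel G).
Proof. by move=> x y; rewrite /compl_rel eq_sym adj_sym. Qed.

Lemma compl_rel_irr (T : finType) (G : sgraph T) : irreflexive (compl_rel G).
Proof. by move=> x; rewrite /compl_rel eqxx. Qed.

Definition compl (T : finType) (G : sgraph T) : sgraph T :=
  SGraph (compl_rel_sym G) (compl_rel_irr G).

Definition induced_rel (T : finType) (G : sgraph T) (A : {set T}) :
    rel {x : T | x \in A} :=
  fun x y => adj G (val x) (val y).

Lemma induced_rel_sym (T : finType) (G : sgraph T) (A : {set T}) :
  symmetric (@induced_rel T G A).
Proof. by move=> x y; apply: adj_sym. Qed.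

Lemma induced_rel_irr (T : finType) (G : sgraph T) (A : {set T}) :
  irreflexive (@induced_rel T G A).
Proof. by move=> x; apply: adj_irr. Qed.

Definition induced (T : finType) (G : sgraph T) (A : {set T}) :
    sgraph {x : T | x \in A} :=
  SGraph (@induced_rel_sym T G A) (@induced_rel_irr T G A).

Definition isomorphic (T U : finType) (G : sgraph T) (H : sgraph U) : Prop :=
  exists f : T -> U,
    bijective f /\ forall x y, adj H (f x) (f y) = adj G x y.

(* The conjunct i != j only matters for k = 1. The graph is the cycle on k
   vertices when 3 <= k. *)
Definition cycle_rel (k : nat) : rel 'I_k :=
  fun i j => (i != j) && ((j == ordS i) || (i == ordS j)).

Lemma cycle_rel_sym k : symmetric (@cycle_rel k).
Proof. by move=> i j; rewrite /cycle_rel eq_sym orbC. Qed.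

Lemma cycle_rel_irr k : irreflexive (@cycle_rel k).
Proof. by move=> i; rewrite /cycle_rel eqxx. Qed.

Definition cycle_graph (k : nat) : sgraph 'I_k :=
  SGraph (@cycle_rel_sym k) (@cycle_rel_irr k).

Definition hole_free (T : finType) (G : sgraph T) : Prop :=
  forall (A : {set T}) (k : nat),
    5 <= k -> ~ isomorphic (induced G A) (cycle_graph k).

Definition edges_between (T : finType) (G : sgraph T) (A B : {set T}) :
    {set {set T}} :=
  [set [set x; y] | x in A, y in B & adj G x y].

Definition perfect_matching (T : finType) (M : {set {set T}}) : Prop :=
  forall v : T, #|[set e in M | v \in e]| = 1.

(* Nonemptiness of the parts is automatic when T is inhabited, since every
   vertex needs a matching edge; the graph without vertices is a yes-instance. *)
Definition comp_sub_PM (T : finType) (G : sgraph T) : Prop :=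
  exists V1 V2 : {set T},
    [/\ V1 :|: V2 = [set: T], [disjoint V1 & V2],
        isomorphic (induced G V1) (compl (induced G V2)) &
        perfect_matching (edges_between G V1 V2)].

(* Model of computation: a random access machine with registers and an
   indirectly addressed memory, programmed with structured control flow. Every
   instruction and every test costs one unit. Addition and truncated
   subtraction are the only arithmetic, so the bit lengths of all numbers grow
   at most linearly with the running time, and polynomial time here coincides
   with polynomial time on Turing machines. *)
Inductive cmd : Type :=
| Skip
| Const of nat & nat          (* r[x] := k            *)
| Add of nat & nat & nat      (* r[x] := r[y] + r[z]  *)
| Sub of nat & nat & nat      (* r[x] := r[y] - r[z]  *)
| Read of nat & nat           (* r[x] := m[r[y]]      *)
| Write of nat & nat          (* m[r[x]] := r[y]      *)
| Seq of cmd & cmd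
| If of nat & cmd & cmd       (* tests r[x] != 0      *)
| While of nat & cmd.         (* tests r[x] != 0      *)

Record state := State { reg : nat -> nat; mem : nat -> nat }.

Definition upd (f : nat -> nat) (x v : nat) : nat -> nat :=
  fun y => if y == x then v else f y.

Definition set_reg (s : state) (x v : nat) : state :=
  State (upd (reg s) x v) (mem s).

Definition set_mem (s : state) (a v : nat) : state :=
  State (reg s) (upd (mem s) a v).

(* exec c s t s': started in s, the command c halts in s' after time t. *)
Inductive exec : cmd -> state -> nat -> state -> Prop :=
| ExecSkip s : exec Skip s 1 s
| ExecConst x k s : exec (Const x k) s 1 (set_reg s x k)
| ExecAdd x y z s : exec (Add x y z) s 1 (set_reg s x (reg s y + reg s z))
| ExecSub x y z s : exec (Sub x y z) s 1 (set_reg s x (reg s y - reg s z))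
| ExecRead x y s : exec (Read x y) s 1 (set_reg s x (mem s (reg s y)))
| ExecWrite x y s : exec (Write x y) s 1 (set_mem s (reg s x) (reg s y))
| ExecSeq c1 c2 s1 s2 s3 t1 t2 :
    exec c1 s1 t1 s2 -> exec c2 s2 t2 s3 -> exec (Seq c1 c2) s1 (t1 + t2) s3
| ExecIfT x c1 c2 s s' t :
    reg s x != 0 -> exec c1 s t s' -> exec (If x c1 c2) s t.+1 s'
| ExecIfF x c1 c2 s s' t :
    reg s x = 0 -> exec c2 s t s' -> exec (If x c1 c2) s t.+1 s'
| ExecWhileT x c s1 s2 s3 t1 t2 :
    reg s1 x != 0 -> exec c s1 t1 s2 -> exec (While x c) s2 t2 s3 ->
    exec (While x c) s1 (t1 + t2).+1 s3
| ExecWhileF x c s : reg s x = 0 -> exec (While x c) s 1 s.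

Lemma exec_det c s t1 s1 t2 s2 :
  exec c s t1 s1 -> exec c s t2 s2 -> t1 = t2 /\ s1 = s2.
Proof.
move=> E1; move: t2 s2; elim: E1 => {c s t1 s1};
  intros; match goal with E : exec _ _ _ _ |- _ => inversion E; subst end;
  try match goal with
  | N : is_true (reg ?s ?x != 0), Z : reg ?s ?x = 0 |- _ => by rewrite Z in N
  end;
  repeat match goal with
  | IH : (forall _ _, exec ?c ?s _ _ -> _ /\ _), E : exec ?c ?s _ _ |- _ =>
      case: (IH _ _ E) => ? ?; subst; clear IH
  end; split; congruence.
Qed.

(* The input word occupies the first cells of the memory, its length is in
   register 0; everything else is 0. *)
Definition init (w : seq bool) : state :=
  State (upd (fun=> 0) 0 (size w)) (fun a => nth false w a : nat).

Definition accepting (s : state) : Prop := reg s 0 != 0.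

(* 1^n 0 followed by the n * n adjacency matrix, row by row. *)
Definition encode (n : nat) (G : sgraph 'I_n) : seq bool :=
  nseq n true ++ false :: [seq adj G i j | i <- enum 'I_n, j <- enum 'I_n].

(* A single program, correct and within one polynomial time bound on all
   graphs of the class; nothing is required outside the class. *)
Definition solvable_in_poly_time_on
    (class problem : forall T : finType, sgraph T -> Prop) : Prop :=
  exists (p : cmd) (c d : nat),
    forall (n : nat) (G : sgraph 'I_n), class 'I_n G ->
      exists (t : nat) (s : state),
        [/\ exec p (init (encode G)) t s,
            t <= c * size (encode G) ^ d + c &
            accepting s <-> problem 'I_n G].

(* Main.v *)
Require Import Defs.
From Stdlib Require Import Classical.
From mathcomp Require Import all_boot zify.

Set Implicit Arguments.
Unset Strict Implicit.
Unset Printing Implicit Defensive.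

(** Let [H = G[V1]] and let [K] be [G[V2]] transported to [V1] along the perfect
    matching, so that [K] is isomorphic to the complement of [H].  If a path of
    [H] and a path of [K] have the same ends and are otherwise disjoint, they
    close up to an induced cycle of [G]; hence in a hole-free graph they have at
    most two edges in total.

    Suppose that the complement of [H] is disconnected.  If [K] had an induced
    path on three vertices, its middle vertex [b] would be adjacent to all
    others in [H], all such paths of [K] would have [b] in the middle, and
    [H] and [K] would be equal and homogeneous on all but three vertices, which
    is impossible for a graph and its complement.  So [K] is a disjoint union of
    cliques and [H] is complete multipartite.  The case where the complement of
    [K] is disconnected is symmetric.  In the remaining case [H] and [K] are
    connected, shortest paths give [H = K], two nonadjacent vertices have at most
    one common neighbour, and two adjacent ones at most one common non-neighbour;
    as [H] contains both [K_4] and its complement as soon as it is large, by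
    Ramsey's theorem and self-complementarity, its size is bounded.

    In the multipartite case any edge [vw] of [V1], with partners [v'] and [w'],
    determines [V1] as [N(v) \cup N(w) \ {v', w'}].  There are thus at most [n^4]
    partitions to test, and a complete multipartite graph is the complement of a
    disjoint union of cliques when the part sizes agree.  The graphs of bounded
    size are handled by a finite table. *)

(** * Expressions and their compilation *)

(* Every bound variable ranges over the numbers below [rho 0], which holds the
   length of the input; hence every fixed expression takes polynomial time. *)
Inductive expr : Type :=
| EVar of nat
| ECst of nat
| EAdd of expr & expr
| ESub of expr & expr
| ERead of expr
| EIf of expr & expr & expr
| ESum of nat & expr.

Fixpoint eval (m rho : nat -> nat) (e : expr) : nat :=
  match e with
  | EVar x => rho x
  | ECst k => k
  | EAdd a b => eval m rho a + eval m rho b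
  | ESub a b => eval m rho a - eval m rho b
  | ERead a => m (eval m rho a)
  | EIf a b c => if eval m rho a != 0 then eval m rho b else eval m rho c
  | ESum x a => \sum_(i < rho 0) eval m (upd rho x i) a
  end.

(** A bound variable is never 0, since [rho 0] is the range of every sum, and it stays below [r],
    where the scratch registers of the compiled code begin. *)
Fixpoint wf (r : nat) (e : expr) : bool :=
  match e with
  | EVar x => x < r
  | ECst _ => true
  | EAdd a b | ESub a b => wf r a && wf r b
  | ERead a => wf r a
  | EIf a b c => [&& wf r a, wf r b & wf r c]
  | ESum x a => [&& 0 < x, x < r & wf r a]
  end.

Lemma wf_leq r r' e : r <= r' -> wf r e -> wf r' e.
Proof.
move=> le_r; elim: e => //=.
- by move=> x xr; apply: leq_trans le_r.
- by move=> a IHa b IHb /andP[/IHa-> /IHb->].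
- by move=> a IHa b IHb /andP[/IHa-> /IHb->].
- by move=> a IHa b IHb c IHc /and3P[/IHa-> /IHb-> /IHc->].
- by move=> x a IHa /and3P[-> xr /IHa->]; rewrite (leq_trans xr).
Qed.

Lemma eval_ext m r e rho rho' : 0 < r -> wf r e ->
  (forall i, i < r -> rho i = rho' i) -> eval m rho e = eval m rho' e.
Proof.
move=> r0; elim: e rho rho' => //=.
- by move=> x rho rho' xr ->.
- by move=> a IHa b IHb rho rho' /andP[wa wb] E; rewrite (IHa _ rho') ?(IHb _ rho').
- by move=> a IHa b IHb rho rho' /andP[wa wb] E; rewrite (IHa _ rho') ?(IHb _ rho').
- by move=> a IHa rho rho' wa E; rewrite (IHa _ rho').
- move=> a IHa b IHb c IHc rho rho' /and3P[wa wb wc] E.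
  by rewrite (IHa _ rho') ?(IHb _ rho') ?(IHc _ rho').
- move=> x a IHa rho rho' /and3P[x0 xr wa] E; rewrite E //.
  by apply: eq_bigr => i _; apply: IHa => // j jr; rewrite /upd E.
Qed.

(* The value of [e] is left in register [r]; registers below [r] hold the
   variables and are preserved, registers above [r] are scratch space. *)
Fixpoint compile (r : nat) (e : expr) : cmd :=
  match e with
  | EVar x => Seq (Const r 0) (Add r r x)
  | ECst k => Const r k
  | EAdd a b => Seq (compile r a) (Seq (compile r.+1 b) (Add r r r.+1))
  | ESub a b => Seq (compile r a) (Seq (compile r.+1 b) (Defs.Sub r r r.+1))
  | ERead a => Seq (compile r a) (Read r r)
  | EIf a b c => Seq (compile r a) (If r (compile r b) (compile r c))
  | ESum x a =>
      Seq (Const r 0) (Seq (Add r.+1 r x) (Seq (Const x 0)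
     (Seq (Defs.Sub r.+2 0 x)
     (Seq (While r.+2
            (Seq (compile r.+3 a) (Seq (Add r r r.+3) (Seq (Const r.+3 1)
            (Seq (Add x x r.+3) (Defs.Sub r.+2 0 x))))))
     (Seq (Const x 0) (Add x x r.+1))))))
  end.

(** Only an upper bound: both branches of a conditional are charged. A round of a sum pays for the
    body, four more instructions and the loop test. *)
Fixpoint cost (L : nat) (e : expr) : nat :=
  match e with
  | EVar _ => 2
  | ECst _ => 1
  | EAdd a b | ESub a b => cost L a + cost L b + 1
  | ERead a => cost L a + 1
  | EIf a b c => cost L a + cost L b + cost L c + 1
  | ESum _ a => L * (cost L a + 5) + 8
  end.

(** The base [L.+1] is positive, so powers grow with the exponent and bounds of different degrees
    can be added. *)
Lemma cost_poly e : exists C D, forall L, cost L e <= C * L.+1 ^ D.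
Proof.
have grow C D C' D' L : C <= C' -> D <= D' -> C * L.+1 ^ D <= C' * L.+1 ^ D'.
  by move=> hC hD; rewrite leq_mul // leq_pexp2l.
have bin a b : (exists C D, forall L, cost L a <= C * L.+1 ^ D) ->
    (exists C D, forall L, cost L b <= C * L.+1 ^ D) ->
    exists C D, forall L, cost L a + cost L b + 1 <= C * L.+1 ^ D.
  move=> [C [D h]] [C' [D' h']]; exists (C + C' + 1), (D + D') => L.
  rewrite !mulnDl; apply: leq_add; first apply: leq_add.
  - by apply: leq_trans (h L) _; apply: grow; lia.
  - by apply: leq_trans (h' L) _; apply: grow; lia.
  - by rewrite mul1n expn_gt0.
elim: e => /=.
- by move=> _; exists 2, 0 => L; rewrite expn0.
- by move=> _; exists 1, 0 => L; rewrite expn0.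
- by move=> a IHa b IHb; apply: bin.
- by move=> a IHa b IHb; apply: bin.
- move=> a [C [D h]]; exists C.+1, D => L.
  by rewrite mulSn addnC leq_add ?expn_gt0.
- move=> a [C [D h]] b [C' [D' h']] c [C2 [D2 h2]].
  exists (C + C' + C2 + 1), (D + D' + D2) => L.
  rewrite !mulnDl; apply: leq_add; last by rewrite mul1n expn_gt0.
  apply: leq_add; first apply: leq_add.
  - by apply: leq_trans (h L) _; apply: grow; lia.
  - by apply: leq_trans (h' L) _; apply: grow; lia.
  - by apply: leq_trans (h2 L) _; apply: grow; lia.
- move=> _ a [C [D h]]; exists (C + 13), D.+1 => L.
  have := h L; have : 0 < L.+1 ^ D by rewrite expn_gt0.
  rewrite expnS; set X := L.+1 ^ D => X0 hL.
  apply: (@leq_trans (L.+1 * (C * X + 5 * X) + 8 * (L.+1 * X))); last by nia.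
  apply: leq_add; last by nia.
  by apply: leq_mul => //; apply: leq_add => //; nia.
Qed.

Lemma reg_set s x v y : reg (set_reg s x v) y = if y == x then v else reg s y.
Proof. by []. Qed.

(** A second operand is compiled one register higher, so the first value survives; the variables
    below [r] are unchanged, and [eval_ext] carries its value back to the initial state. *)
Lemma compile_correct e r s : 0 < r -> wf r e ->
  exists t s', [/\ exec (compile r e) s t s', t <= cost (reg s 0) e,
    reg s' r = eval (Defs.mem s) (reg s) e,
    forall i, i < r -> reg s' i = reg s i & Defs.mem s' = Defs.mem s].
Proof.
elim: e r s => /=.
- move=> x r s r0 xr; do 2!eexists; split.
  + exact: (ExecSeq (ExecConst _ _ _) (ExecAdd _ _ _ _)).
  + by [].
  + by rewrite !reg_set !eqxx (ltn_eqF xr).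
  + by move=> i ir; rewrite !reg_set (ltn_eqF ir).
  + by [].
- move=> k r s r0 _; do 2!eexists; split; first exact: ExecConst.
  + by [].
  + by rewrite reg_set eqxx.
  + by move=> i ir; rewrite reg_set (ltn_eqF ir).
  + by [].
- move=> a IHa b IHb r s r0 /andP[wa wb].
  have [t1 [s1 [E1 T1 V1 P1 M1]]] := IHa r s r0 wa.
  have [t2 [s2 [E2 T2 V2 P2 M2]]] := IHb r.+1 s1 isT (wf_leq (leqnSn r) wb).
  do 2!eexists; split.
  + exact: (ExecSeq E1 (ExecSeq E2 (ExecAdd _ _ _ _))).
  + by move: T1 T2; rewrite (P1 0) //; lia.
  + rewrite reg_set eqxx P2 // V1 V2 M1; congr (_ + _).
    exact: (eval_ext _ r0 wb).
  + by move=> i ir; rewrite reg_set (ltn_eqF ir) P2 ?P1 // ltnW.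
  + by rewrite /= M2 M1.
- move=> a IHa b IHb r s r0 /andP[wa wb].
  have [t1 [s1 [E1 T1 V1 P1 M1]]] := IHa r s r0 wa.
  have [t2 [s2 [E2 T2 V2 P2 M2]]] := IHb r.+1 s1 isT (wf_leq (leqnSn r) wb).
  do 2!eexists; split.
  + exact: (ExecSeq E1 (ExecSeq E2 (ExecSub _ _ _ _))).
  + by move: T1 T2; rewrite (P1 0) //; lia.
  + rewrite reg_set eqxx P2 // V1 V2 M1; congr (_ - _).
    exact: (eval_ext _ r0 wb).
  + by move=> i ir; rewrite reg_set (ltn_eqF ir) P2 ?P1 // ltnW.
  + by rewrite /= M2 M1.
- move=> a IHa r s r0 wa.
  have [t1 [s1 [E1 T1 V1 P1 M1]]] := IHa r s r0 wa.
  do 2!eexists; split.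
  + exact: (ExecSeq E1 (ExecRead _ _ _)).
  + by rewrite leq_add2r.
  + by rewrite reg_set eqxx V1 M1.
  + by move=> i ir; rewrite reg_set (ltn_eqF ir) P1.
  + by [].
- move=> a IHa b IHb c IHc r s r0 /and3P[wa wb wc].
  have [t1 [s1 [E1 T1 V1 P1 M1]]] := IHa r s r0 wa.
  case: (eqVneq (eval (Defs.mem s) (reg s) a) 0) => /= [a0|a1].
  + have [t2 [s2 [E2 T2 V2 P2 M2]]] := IHc r s1 r0 wc.
    do 2!eexists; split.
    * by apply: (ExecSeq E1); apply: (ExecIfF _ _ E2); rewrite V1.
    * by move: T1 T2; rewrite (P1 0) //; lia.
    * by rewrite V2 M1; apply: (eval_ext _ r0 wc).
    * by move=> i ir; rewrite P2 ?P1.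
    * by rewrite M2.
  + have [t2 [s2 [E2 T2 V2 P2 M2]]] := IHb r s1 r0 wb.
    do 2!eexists; split.
    * by apply: (ExecSeq E1); apply: (ExecIfT _ _ E2); rewrite V1.
    * by move: T1 T2; rewrite (P1 0) //; lia.
    * by rewrite V2 M1; apply: (eval_ext _ r0 wb).
    * by move=> i ir; rewrite P2 ?P1.
    * by rewrite M2.
- move=> x a IHa r s r0 /and3P[x0 xr wa].
  set L := reg s 0; set m := Defs.mem s.
  set body := Seq (compile r.+3 a) _.
  (* Loop invariant: [k] rounds remain, [x] holds [L - k], register [r] accumulates the sum, and
     [r.+1], which saves the outer value of [x], is not touched. *)
  have loop k s1 : k <= L -> Defs.mem s1 = m -> reg s1 r.+2 = k -> reg s1 x = L - k ->
      (forall i, i < r -> i != x -> reg s1 i = reg s i) ->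
    exists t s', [/\ exec (While r.+2 body) s1 t s', t <= k * (cost L a + 5) + 1,
      reg s' r = reg s1 r + \sum_(L - k <= i < L) eval m (upd (reg s) x i) a,
      reg s' r.+1 = reg s1 r.+1 &
      (forall i, i < r -> i != x -> reg s' i = reg s i) /\ Defs.mem s' = m].
    elim: k s1 => [|k IHk] s1 kL M1 c1 x1 P1.
      exists 1, s1; split=> //; first exact: ExecWhileF.
      by rewrite subn0 big_geq // addn0.
    have w3 : wf r.+3 a by apply: wf_leq wa; lia.
    have [t2 [s2 [E2 T2 V2 P2 M2]]] := IHa r.+3 s1 isT w3.
    pose s3 := set_reg s2 r (reg s2 r + reg s2 r.+3).
    pose s4 := set_reg s3 r.+3 1.
    pose s5 := set_reg s4 x (reg s4 x + reg s4 r.+3).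
    pose s6 := set_reg s5 r.+2 (reg s5 0 - reg s5 x).
    have E : exec body s1 (t2 + (1 + (1 + (1 + 1)))) s6.
      apply: (ExecSeq E2); apply: (ExecSeq (ExecAdd _ _ _ _)).
      apply: (ExecSeq (ExecConst _ _ _)); apply: (ExecSeq (ExecAdd _ _ _ _)).
      exact: ExecSub.
    have s10 : reg s1 0 = L by rewrite P1 // eq_sym -lt0n.
    have s4x : reg s4 x = L - k.+1.
      by rewrite !reg_set ifN ?ifN ?P2 //; lia.
    have s5x : reg s5 x = L - k.
      by rewrite reg_set eqxx s4x reg_set eqxx; lia.
    have s50 : reg s5 0 = L.
      rewrite !reg_set ifN ?ifN ?ifN ?P2 //; lia.
    have low i : i < r -> i != x -> reg s6 i = reg s i.
      move=> ir ix; rewrite !reg_set (negbTE ix) ifN ?ifN ?ifN ?P2 ?P1 //; lia.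
    have [|||||t7 [s7 [E7 T7 A7 B7 [P7 M7]]]] := IHk s6 => //.
    + lia.
    + by rewrite /= M2.
    + by rewrite reg_set eqxx s50 s5x; lia.
    + by rewrite reg_set ifN ?s5x //; lia.
    exists (t2 + (1 + (1 + (1 + 1))) + t7).+1, s7; split=> //.
    + by apply: (ExecWhileT _ E E7); rewrite c1.
    + by move: T2 T7; rewrite s10; lia.
    + rewrite A7 [in RHS]big_ltn; last by lia.
      rewrite addnA; congr (_ + _); last by rewrite -subSn.
      have -> : reg s6 r = reg s2 r + reg s2 r.+3.
        rewrite reg_set ifN; last by lia.
        rewrite reg_set ifN; last by lia.
        by rewrite reg_set ifN ?reg_set ?eqxx //; lia.
      rewrite P2; last by lia.
      rewrite V2 M1; congr (_ + _); apply: (eval_ext _ r0 wa) => i ir.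
      by rewrite /upd; case: eqVneq => [->|ix]; [rewrite x1 | rewrite P1].
    + rewrite B7 reg_set ifN; last by lia.
      rewrite reg_set ifN; last by lia.
      rewrite reg_set ifN; last by lia.
      by rewrite reg_set ifN ?P2 //; lia.
  pose s1 := set_reg s r 0.
  pose s2 := set_reg s1 r.+1 (reg s1 r + reg s1 x).
  pose s3 := set_reg s2 x 0.
  pose s4 := set_reg s3 r.+2 (reg s3 0 - reg s3 x).
  have s2x : reg s2 r.+1 = reg s x.
    by rewrite reg_set eqxx !reg_set eqxx ifN //; lia.
  have s30 : reg s3 0 = L.
    by rewrite !reg_set !ifN //; lia.
  have s3x : reg s3 x = 0 by rewrite reg_set eqxx.
  have s3r : reg s3 r = 0.
    rewrite reg_set ifN; last by lia.
    rewrite reg_set ifN; last by lia.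
    by rewrite reg_set eqxx.
  have [|||||t6 [s6 [E6 T6 A6 B6 [P6 M6]]]] := loop L s4 => //.
  + by rewrite reg_set eqxx s30 s3x subn0.
  + by rewrite reg_set ifN ?s3x ?subnn //; lia.
  + move=> i ir ix; rewrite reg_set ifN; last by lia.
    by rewrite reg_set (negbTE ix) !reg_set !ifN //; lia.
  (* The variable [x] gets its outer value back from [r.+1]. *)
  pose s7 := set_reg s6 x 0.
  pose s8 := set_reg s7 x (reg s7 x + reg s7 r.+1).
  exists (1 + (1 + (1 + (1 + (t6 + (1 + 1)))))), s8; split.
  + apply: (ExecSeq (ExecConst _ _ _)); apply: (ExecSeq (ExecAdd _ _ _ _)).
    apply: (ExecSeq (ExecConst _ _ _)).
    apply: (ExecSeq (ExecSub _ _ _ _)); apply: (ExecSeq E6).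
    by apply: (ExecSeq (ExecConst _ _ _)); apply: ExecAdd.
  + by move: T6; lia.
  + rewrite reg_set ifN; last by lia.
    rewrite reg_set ifN; last by lia.
    rewrite A6 reg_set ifN; last by lia.
    by rewrite s3r add0n subnn big_mkord.
  + move=> i ir; rewrite reg_set; case: eqVneq => [->|ix]; last first.
      by rewrite reg_set (negbTE ix) P6.
    rewrite reg_set eqxx reg_set ifN; last by lia.
    rewrite B6 reg_set ifN; last by lia.
    by rewrite reg_set ifN ?s2x //; lia.
  + exact: M6.
Qed.

Lemma solvable_of_expr (class problem : forall T : finType, sgraph T -> Prop)
    (e : expr) (r : nat) : 0 < r -> wf r e ->
  (forall n (G : sgraph 'I_n), class 'I_n G ->
     (eval (Defs.mem (init (encode G))) (reg (init (encode G))) e != 0) <->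
     problem 'I_n G) ->
  solvable_in_poly_time_on class problem.
Proof.
move=> r0 we correct; have [C [D costP]] := cost_poly e.
exists (Seq (compile r e) (Seq (Const 0 0) (Add 0 0 r))), (C * 2 ^ D + 2), D.
move=> n G clG; have [t [s [E T V _ _]]] := compile_correct (init (encode G)) r0 we.
do 2!eexists; split.
- exact: (ExecSeq E (ExecSeq (ExecConst _ _ _) (ExecAdd _ _ _ _))).
- have L0 : 0 < size (encode G) by rewrite size_cat /= addnS.
  have {}T : t <= C * (size (encode G)).+1 ^ D := leq_trans T (costP _).
  (* The input is nonempty, so its length plus one is at most twice its length. The 2 pays for
     moving the result to register 0. *)
  apply: (@leq_trans (C * (2 * size (encode G)) ^ D + 2)).
    apply: leq_add => //; apply: (leq_trans T).
    rewrite leq_mul2l; case: (posnP D) => [->|D0]; first by rewrite orbT.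
    by rewrite leq_exp2r //; lia.
  by rewrite expnMn; nia.
- rewrite /accepting reg_set eqxx reg_set eqxx reg_set (gtn_eqF r0) V add0n.
  exact: correct.
Qed.

(** * Graphs joined by a perfect matching *)

(** The image of such a sequence induces a copy of [cycle_graph k]. Numbering the vertices by
    naturals turns later cycle checks into linear arithmetic; symmetry reduces them to [i < j]. *)
Lemma hole_freeP (T : finType) (G : sgraph T) (k : nat) (c : nat -> T) :
  hole_free G ->
  (forall i j, i < j -> j < k -> c i != c j /\
     adj G (c i) (c j) = (j == i.+1) || ((i == 0) && (j == k.-1))) ->
  k < 5.
Proof.
move=> hG hc; rewrite ltnNge; apply/negP => k5.
have cinj i j : i < k -> j < k -> c i = c j -> i = j.
  move=> ik jk cij; case: (ltngtP i j) => // ij.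
    by have [] := hc _ _ ij jk; rewrite cij eqxx.
  by have [] := hc _ _ ij ik; rewrite cij eqxx.
pose A := [set c i | i : 'I_k].
have cA (i : 'I_k) : c i \in A by rewrite imset_f.
pose g (i : 'I_k) : {x | x \in A} := exist _ (c i) (cA i).
have gbij : bijective g.
  apply: inj_card_bij => [i j [/cinj ij]|].
    by apply: val_inj; apply: ij.
  rewrite card_sig (eq_card (B := A)) // card_imset ?card_ord // => i j /cinj ij.
  by apply: val_inj; apply: ij.
case: (gbij) => f gK fK.
apply: (hG A k k5); exists f; split; first by exists g.
have ordSE (i : 'I_k) : ordS i = (if i.+1 == k then 0 else i.+1) :> nat.
  rewrite /=; case: eqVneq => [->|ne]; first by rewrite modnn.
  by rewrite modn_small //; have := ltn_ord i; lia.
have adjE (i j : 'I_k) : cycle_rel i j = adj G (c i) (c j).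
  rewrite /cycle_rel -!val_eqE [val (ordS i)]ordSE [val (ordS j)]ordSE.
  case: i j => i ik [j jk] /=.
  case: (ltngtP i j) => [ij|ij|->] /=; last by rewrite adj_irr.
    have [_ ->] := hc _ _ ij jk; rewrite [i.+1 == k]ltn_eqF; last by lia.
    by case: (eqVneq j.+1 k) => e; lia.
  rewrite adj_sym; have [_ ->] := hc _ _ ij ik.
  rewrite [j.+1 == k]ltn_eqF; last by lia.
  by case: (eqVneq i.+1 k) => e; lia.
move=> x y; rewrite -{2}(fK x) -{2}(fK y); exact: adjE.
Qed.

Section Pairs.

Variable U : finType.
Implicit Types (H K : rel U).

Definition ipath H l (p : nat -> U) :=
  forall i j, i < j -> j <= l -> p i != p j /\ H (p i) (p j) = (j == i.+1).

(* No induced cycle of length at least 5 runs along a path [p] of [H] and back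
   along a path [q] of [K] in the graph obtained from disjoint copies of [H]
   and [K] by joining the two copies of each vertex. *)
Definition no_holes H K := forall l k p q,
  ipath H l p -> ipath K k q -> p 0 = q 0 -> p l = q k ->
  (forall i j, i <= l -> j <= k -> p i = q j ->
     (i == 0) && (j == 0) || (i == l) && (j == k)) ->
  l + k <= 2.

Lemma no_holes_sym H K : no_holes H K -> no_holes K H.
Proof.
move=> NH l k p q hp hq e0 e1 d; rewrite addnC; apply: (NH k l q p) => //.
by move=> i j ik jl /esym/(d _ _ jl ik); rewrite andbC [(j == l) && _]andbC.
Qed.

Definition corel H : rel U := fun x y => (x != y) && ~~ H x y.

Lemma corel_sym H : symmetric H -> symmetric (corel H).
Proof. by move=> sH x y; rewrite /corel eq_sym sH. Qed.

Lemma ipath1 H x y : x != y -> H x y -> ipath H 1 (nth x [:: x; y]).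
Proof. by move=> xy Hxy [|[|i]] [|[|j]]. Qed.

Lemma ipath2 H x c y : x != y -> x != c -> c != y -> H x c -> H c y ->
  ~~ H x y -> ipath H 2 (nth x [:: x; c; y]).
Proof.
by move=> xy xc cy Hxc Hcy /negbTE Hxy [|[|[|i]]] [|[|[|j]]].
Qed.

(** Strong induction on the length of a walk: a repeated vertex or a chord gives a shorter walk, and
    a walk with neither is an induced path. *)
Lemma shortest_ipath H x y : symmetric H -> connect H x y ->
  exists l p, [/\ ipath H l p, p 0 = x & p l = y].
Proof.
move=> sH /connectP[s ps ->].
have : exists p : nat -> U, [/\ p 0 = x, p (size s) = last x s &
    forall i, i < size s -> H (p i) (p i.+1)].
  exists (nth x (x :: s)); split=> //.
    by rewrite -[last x s]/(last x (x :: s)) -nth_last.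
  by move=> i; apply: (pathP x ps).
move: (size s) (last x s) => l {ps s}z.
elim/ltn_ind: l => l IH [p [p0 pl pS]].
case: (boolP [exists i : 'I_l.+1, exists j : 'I_l.+1, (i < j) &&
   ((p i == p j) || (H (p i) (p j) && (j != i.+1 :> nat)))]); last first.
  move=> nex; exists l, p; split=> // i j ij jl.
  have il : i < l.+1 by lia.
  move: nex; rewrite negb_exists => /forallP/(_ (Ordinal il)).
  rewrite negb_exists => /forallP/(_ (Ordinal (jl : j < l.+1))) /=.
  rewrite ij /= negb_or negb_and negbK => /andP[-> h]; split=> //.
  case: (eqVneq j i.+1) h => [->|_]; first by rewrite pS //; lia.
  by rewrite orbF => /negbTE.
case/existsP=> i /existsP[j /andP[ij h]].
have jl := ltn_ord j.
case/orP: h => [/eqP pij|/andP[Hij ne]].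
  (* A repeated vertex: the closed piece from [i] to [j] is cut out. *)
  apply: (IH (l - (j - i))); first by lia.
  exists (fun a => if a <= i then p a else p (a + (j - i))); split=> //.
    case: ifP => h; last by rewrite -pl; congr p; lia.
    by rewrite -pl (_ : l - (j - i) = i) ?pij; [congr p; lia | lia].
  move=> a al; case: (ltngtP a i) => ai.
  - by rewrite pS //; lia.
  - by rewrite addSn pS //; lia.
  - rewrite ai pij (_ : i.+1 + (j - i) = j.+1); last by lia.
    by rewrite pS //; lia.
(* A chord replaces the [j - i] steps from [i] to [j] by one. *)
apply: (IH (l - (j - i).-1)); first by lia.
exists (fun a => if a <= i then p a else p (a + (j - i).-1)); split=> //.
  by rewrite ifN; [rewrite -pl; congr p; lia|lia].
move=> a al; case: (ltngtP a i) => ai.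
- by rewrite pS //; lia.
- by rewrite addSn pS //; lia.
- by rewrite ai (_ : i.+1 + (j - i).-1 = j) //; lia.
Qed.

(** A shortest path of [H], of length [l], and the edge of [K] between its ends force [l + 1 <= 2],
    so the path is a single edge. *)
Lemma no_long_hole H K x y : symmetric H -> irreflexive K -> no_holes H K ->
  connect H x y -> K x y -> H x y.
Proof.
move=> sH iK NH cxy Kxy.
have xy : x != y by apply: contraTneq Kxy => ->; rewrite iK.
have [l [p [hp p0 pl]]] := shortest_ipath sH cxy.
have l0 : 0 < l by case: (posnP l) => // l0; move: xy; rewrite -p0 -pl l0 eqxx.
suff : l + 1 <= 2.
  move=> l2; have [_] := hp 0 l l0 (leqnn l).
  by rewrite p0 pl => ->; rewrite (_ : l = 1) //; lia.
apply: (NH _ _ _ _ hp (ipath1 xy Kxy)) => //= i [|[|j]] //= il _ e.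
  case: i il e => [|i] il // e.
  by have [] := hp 0 i.+1 isT il; rewrite e p0 eqxx.
rewrite andbF andbT /=; case: (ltngtP i l) il e => // il _ e.
by have [] := hp i l il (leqnn l); rewrite e pl eqxx.
Qed.

Lemma ramsey H s t (A : {set U}) : symmetric H -> 2 ^ (s + t) <= #|A| ->
  (exists2 B : {set U}, s <= #|B| &
     B \subset A /\ {in B &, forall x y, x != y -> H x y}) \/
  (exists2 B : {set U}, t <= #|B| &
     B \subset A /\ {in B &, forall x y, x != y -> ~~ H x y}).
Proof.
move=> sH; move: {2}(s + t) (erefl (s + t)) => n; elim: n s t A => [|n IH] s t A.
  case: s t => [|s] [|t] // _ _; left; exists set0; rewrite ?cards0 //.
  by split=> [|x y]; rewrite ?sub0set // inE.
case: s => [_ _|s].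
  left; exists set0; rewrite ?cards0 //.
  by split=> [|x y]; rewrite ?sub0set // inE.
case: t => [_ _|t].
  right; exists set0; rewrite ?cards0 //.
  by split=> [|x y]; rewrite ?sub0set // inE.
move=> st cA.
have /card_gt0P[x xA] : 0 < #|A| by apply: leq_trans cA; rewrite expn_gt0.
pose A1 := [set y in A :\ x | H x y]; pose A0 := [set y in A :\ x | ~~ H x y].
have cA' : #|A1| + #|A0| = #|A|.-1.
  rewrite [in RHS](cardsD1 x) xA add1n /= -(cardsID [set y | H x y] (A :\ x)).
  by congr (_ + _); apply: eq_card => y; rewrite !inE // andbC.
have e2 : 2 ^ (s.+1 + t.+1) = 2 * 2 ^ n by rewrite st expnS.
(* Adding [x] to a homogeneous set among its [P]-neighbours; used with [P] equal to [H] and to its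
   negation. *)
have ext (B : {set U}) (P : rel U) : symmetric P -> B \subset [set y in A :\ x | P x y] ->
    {in B &, forall u v, u != v -> P u v} ->
    [/\ #|x |: B| = #|B|.+1, x |: B \subset A &
      {in x |: B &, forall u v, u != v -> P u v}].
  move=> sP /subsetP BA clB; split.
  - by rewrite cardsU1; case: (boolP (x \in B)) => // /BA; rewrite !inE eqxx.
  - apply/subsetP=> u; rewrite in_setU1 => /orP[/eqP->//|/BA].
    by rewrite !inE => /andP[/andP[]].
  - move=> u v; rewrite !in_setU1 => /orP[/eqP->|uB] /orP[/eqP->|vB] //.
    + by rewrite eqxx.
    + by move: (BA _ vB); rewrite inE => /andP[].
    + by move: (BA _ uB); rewrite inE sP => /andP[].
    + exact: clB.
have sub (P : pred U) : [set y in A :\ x | P y] \subset A.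
  by apply/subsetP => u; rewrite !inE => /andP[/andP[]].
(* The set [A] without [x] has at least [2 * 2 ^ n - 1] elements, so one of its two pieces has at
   least [2 ^ n]. *)
have [c1|c0] : 2 ^ n <= #|A1| \/ 2 ^ n <= #|A0|.
  case: (leqP (2 ^ n) #|A1|) => [|c1]; first by left.
  by right; move: cA; rewrite e2; move: cA' c1; lia.
- have [||[B cB [BA clB]]|[B cB [BA clB]]] := IH s t.+1 A1.
  + by lia.
  + by rewrite (_ : s + t.+1 = n) //; lia.
  + have [e1 e3 e4] := ext B H sH BA clB.
    by left; exists (x |: B); rewrite ?e1.
  + by right; exists B => //; split=> //; apply: subset_trans BA (sub _).
- have [||[B cB [BA clB]]|[B cB [BA clB]]] := IH s.+1 t A0.
  + by lia.
  + by rewrite (_ : s.+1 + t = n) //; lia.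
  + by left; exists B => //; split=> //; apply: subset_trans BA (sub _).
  + have [|e1 e3 e4] := ext B (fun u v => ~~ H u v) _ BA clB.
      by move=> u v; rewrite sH.
    by right; exists (x |: B); rewrite ?e1.
Qed.

(** For irreflexive symmetric relations, [H] is complete multipartite with at least two parts and
    [K] is a disjoint union of cliques. The edge of [H] later serves to locate the whole side. *)
Definition multipartite_cluster H K :=
  [/\ exists x y, H x y,
      forall x y z, ~~ H x y -> ~~ H y z -> ~~ H x z &
      forall x y z, K x y -> K y z -> x != z -> K x z].

(** * A graph and a copy of its complement on the same vertices *)

Section Complementary.

Variables (H K : rel U) (f : U -> U).
Hypotheses (sH : symmetric H) (sK : symmetric K).
Hypotheses (iH : irreflexive H) (iK : irreflexive K).
Hypotheses (fbij : bijective f).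
Hypothesis fE : forall x y, K (f x) (f y) = corel H x y.
Hypothesis NH : no_holes H K.

Let finj : injective f := bij_inj fbij.

Let neqH x y : H x y -> x != y.
Proof. by apply: contraTneq => ->; rewrite iH. Qed.

Let neqK x y : K x y -> x != y.
Proof. by apply: contraTneq => ->; rewrite iK. Qed.

(** An edge of [H] and an induced two-edge path of [K] with the same ends would close up to a hole
    with five vertices. *)
Lemma no_C5 x c y : x != y -> K x c -> K c y -> ~~ K x y -> ~~ H x y.
Proof.
move=> xy Kxc Kcy Kxy; apply/negP => Hxy.
have xc := neqK Kxc; have cy := neqK Kcy.
suff : 1 + 2 <= 2 by [].
apply: (NH (ipath1 xy Hxy) (ipath2 xy xc cy Kxc Kcy Kxy)) => //.
move=> [|[|i]] [|[|[|j]]] //= _ _ /eqP.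
- by rewrite (negbTE xc).
- by rewrite (negbTE xy).
- by rewrite eq_sym (negbTE xy).
- by rewrite eq_sym (negbTE cy).
Qed.

(** By [no_C5] the ends are nonadjacent in [H] as well; with distinct middle vertices the two
    induced paths would close up to a hole with six vertices. *)
Lemma no_C6 x b c y : x != y -> K x c -> K c y -> ~~ K x y ->
  H x b -> H b y -> b = c.
Proof.
move=> xy Kxc Kcy Kxy Hxb Hby; apply/eqP/negPn/negP => bc.
have Hxy := no_C5 xy Kxc Kcy Kxy.
have xc := neqK Kxc; have cy := neqK Kcy.
have xb := neqH Hxb; have by_ := neqH Hby.
suff : 2 + 2 <= 2 by [].
apply: (NH (ipath2 xy xb by_ Hxb Hby Hxy) (ipath2 xy xc cy Kxc Kcy Kxy)) => //.
move=> [|[|[|i]]] [|[|[|j]]] //= _ _ /eqP.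
- by rewrite (negbTE xc).
- by rewrite (negbTE xy).
- by rewrite eq_sym (negbTE xb).
- by rewrite (negbTE bc).
- by rewrite (negbTE by_).
- by rewrite eq_sym (negbTE xy).
- by rewrite eq_sym (negbTE cy).
Qed.

Lemma connect_corel x y : connect (corel H) x y -> connect K (f x) (f y).
Proof.
case/connectP=> p + ->; elim: p x => //= z p IH x /andP[xz zp].
by apply: connect_trans (IH _ zp); apply: connect1; rewrite fE.
Qed.

(** Otherwise [Z] and its preimage under [f] share two vertices [s] and [t]. Then [H s t] and
    [K (f s) (f t)] both equal [b], while [f] complements adjacency. *)
Lemma no_large_homogeneous (Z : {set U}) (b : bool) :
  {in Z &, forall s t, s != t -> H s t = b /\ K s t = b} ->
  2 * #|Z| < #|U| + 2.
Proof.
move=> hZ; rewrite ltnNge; apply/negP => cZ.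
pose Y := f @^-1: Z.
have cY : #|Y| = #|Z|.
  rewrite -(card_imset (mem Y) finj); apply: eq_card => z.
  case: fbij => g fK gK; apply/imsetP/idP => [[y + ->]|zZ]; first by rewrite inE.
  by exists (g z); rewrite ?inE gK.
have : 1 < #|Y :&: Z|.
  have := cardsUI Y Z; have := max_card (Y :|: Z); rewrite cY; move: cZ; clear; lia.
case/card_gt1P=> s [t []]; rewrite !inE => /andP[fs ss] /andP[ft tt] st.
have [e1 _] := hZ _ _ ss tt st.
have [_] := hZ _ _ fs ft (contra_neq (@finj s t) st).
by rewrite fE /corel st e1; case: b {hZ e1}.
Qed.

Lemma co_disconnected_multipartite_cluster a0 c0 :
  8 <= #|U| -> ~~ connect (corel H) a0 c0 -> multipartite_cluster H K.
Proof.
move=> U8 nac.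
have sC : connect_sym (corel H) by apply: sym_connect_sym; apply: corel_sym.
have coP s t : ~~ connect (corel H) s t -> H s t.
  move=> nc; apply: contraNT nc => Hst; case: (eqVneq s t) => [->//|st].
  by apply: connect1; rewrite /corel st.
(* Without an induced two-edge path, [K] is a union of cliques, and [f] turns this into transitivity
   of non-adjacency in [H]. *)
case: (boolP [exists x, exists c, exists y,
    [&& x != y, K x c, K c y & ~~ K x y]]) => [|P3]; last first.
  have Ktr x y z : K x y -> K y z -> x != z -> K x z.
    move=> Kxy Kyz xz; apply: contraNT P3 => Kxz.
    apply/existsP; exists x; apply/existsP; exists y; apply/existsP; exists z.
    exact/and4P.
  split=> //; first by exists a0, c0; apply: coP.
  move=> x y z Hxy Hyz; case: (eqVneq x z) => [->|xz]; first by rewrite iH.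
  case: (eqVneq x y) => [->//|xy]; case: (eqVneq y z) => [<-//|yz].
  have : corel H x z by rewrite -fE (Ktr _ (f y)) ?fE /corel ?xy ?yz // (inj_eq finj).
  by case/andP.
case/existsP=> x /existsP[b /existsP[y /and4P[xy Kxb Kby Kxy]]]; exfalso.
have Hxy := no_C5 xy Kxb Kby Kxy.
have cxy : connect (corel H) x y by rewrite connect1 // /corel xy.
(* A vertex outside the co-component of [x] is an [H]-neighbour of both [x] and [y], hence equals
   [b] by [no_C6]. *)
have outb d : ~~ connect (corel H) x d -> d = b.
  move=> nxd; apply: (no_C6 xy Kxb Kby Kxy); first exact: coP.
  by rewrite sH; apply: coP; apply: contra nxd; apply: connect_trans.
have nxb : ~~ connect (corel H) x b.
  case: (boolP (connect (corel H) x a0)) => [xa|/[dup]/outb-> //].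
  case: (boolP (connect (corel H) x c0)) => [xc|/[dup]/outb-> //].
  by move: nac; rewrite (connect_trans _ xc) // sC.
have conn s : s != b -> connect (corel H) x s.
  by apply: contraNT => /outb->.
have univ s : s != b -> H s b.
  move=> sb; apply: coP; apply: contra nxb; apply: connect_trans; exact: conn.
(* As [b] is adjacent in [H] to all other vertices, it is the middle of a path of [H] between [s]
   and [t]. *)
have centre s c t : s != t -> K s c -> K c t -> ~~ K s t -> c = b.
  move=> st Ksc Kct Kst; have Hst := no_C5 st Ksc Kct Kst.
  case: (eqVneq s b) => [sb|sb].
    by move: Hst; rewrite sb sH univ //; rewrite -sb eq_sym.
  case: (eqVneq t b) => [tb|tb]; first by move: Hst; rewrite tb univ.
  by apply/esym; apply: (no_C6 st Ksc Kct Kst); rewrite ?univ // sH univ.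
have [g fK gK] := fbij.
(* The exceptional vertices: [z] is isolated in [K] because [b] is universal in [H], and [u] is the
   vertex that [f] sends to [b]. *)
pose z := f b; pose u := g b.
have zK s : K z s = false.
  rewrite -(gK s) fE /corel; case: eqVneq => //= bs.
  by rewrite sH univ // eq_sym.
have bz : b != z by apply: contraTneq Kby => ->; rewrite zK.
have ub : u != b by apply: contra_neq bz => e; rewrite /z -[in RHS]e /u gK.
(* The vertices other than [z] are connected in [K], being the image of a co-component. Along a path
   from [b], a first vertex not adjacent to [b] would give an induced path whose middle is not
   [b]. *)
have Kb s : s != z -> s != b -> K b s.
  move=> sz sb; have gb : g s != b by apply: contra_neq sz => e; rewrite /z -e gK.
  have : connect K b s.
    rewrite -(gK s) -(gK b); apply: connect_corel.
    by apply: connect_trans (conn _ gb); rewrite sC; apply: conn.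
  case/connectP=> p pp es; rewrite es in sb *.
  have : (last b p == b) || K b (last b p).
    elim/last_ind: p {s es sz gb sb} pp => [|p s IH]; first by rewrite eqxx.
    rewrite rcons_path last_rcons => /andP[/IH{}IH Kps].
    case: (eqVneq s b) => //= sb.
    case/orP: IH Kps => [/eqP->//|Kb1 Kps].
    apply: contraT => nb; have := centre b (last b p) s.
    rewrite eq_sym => /(_ sb Kb1 Kps nb) e.
    by rewrite e iK in Kb1.
  by rewrite (negbTE sb).
have HK s t : s != z -> s != b -> t != z -> t != b -> s != t -> H s t = K s t.
  move=> sz sb tz tb st; apply/idP/idP.
    apply: contraTT => Kst; apply: (@no_C5 s b t) => //; last exact: Kb.
    by rewrite sK; apply: Kb.
  move=> Kst; apply: (no_long_hole (K := K)) => //.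
  apply: (@connect_trans _ _ b); apply: connect1; first exact: univ.
  by rewrite sH univ.
pose Z := ~: [set b; z; u].
have cZ : #|U| <= #|Z| + 3.
  have := cardsC [set b; z; u]; rewrite -/Z.
  have : #|[set b; z; u]| <= 3.
    by rewrite setUC !cardsU1 cards1; do 2!case: (_ \in _).
  by clear; lia.
have inZ s : s \in Z -> [/\ s != z, s != b & s != u].
  by rewrite !inE !negb_or -andbA => /and3P[-> -> ->].
(* On [Z] adjacency is transitive since [b] is excluded, and non-adjacency is transitive since [u]
   is excluded. *)
have Htr s t r : s \in Z -> t \in Z -> r \in Z -> s != t -> t != r -> s != r ->
    H s t -> H t r -> H s r.
  move=> /inZ[s1 s2 s3] /inZ[t1 t2 t3] /inZ[r1 r2 r3] st tr sr.
  rewrite !HK // => Kst Ktr; apply: contraT => Ksr.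
  by move: t2; rewrite (centre _ _ _ sr Kst Ktr Ksr) eqxx.
have Ctr s t r : s \in Z -> t \in Z -> r \in Z -> s != t -> t != r -> s != r ->
    ~~ H s t -> ~~ H t r -> ~~ H s r.
  move=> /inZ[s1 s2 s3] /inZ[t1 t2 t3] /inZ[r1 r2 r3] st tr sr Hst Htr'.
  suff : K (f s) (f r) by rewrite fE => /andP[].
  apply: contraT => nK.
  have := @centre (f s) (f t) (f r); rewrite (inj_eq finj) => /(_ sr) C.
  have e : f t = b by apply: C; rewrite // fE /corel ?st ?tr.
  by move: t3; rewrite /u -e fK eqxx.
have /card_gt0P[s sZ] : 0 < #|Z| by move: U8 cZ; clear; lia.
suff [c hc] : exists c, {in Z &, forall t r, t != r -> H t r = c}.
  (* Together with [#|U| <= #|Z| + 3] this bound yields [#|U| < 8]. *)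
  suff : 2 * #|Z| < #|U| + 2 by move: U8 cZ; clear; lia.
  apply: (@no_large_homogeneous Z c) => t r tZ rZ tr.
  have [t1 t2 _] := inZ _ tZ; have [r1 r2 _] := inZ _ rZ.
  by rewrite -HK // hc.
(* With both relations transitive, [s] is adjacent to all of [Z] or to none of it, and this value
   spreads to all pairs. *)
case: (boolP [forall t in Z, (t != s) ==> H s t]) => [/forall_inP all1|].
  exists true => t r tZ rZ tr.
  case: (eqVneq t s) => [ts|ts].
    by move: (all1 r rZ); rewrite ts in tr *; rewrite eq_sym tr.
  case: (eqVneq r s) => [rs|rs].
    by move: (all1 t tZ); rewrite ts rs sH.
  apply: (Htr t s r) => //; first by rewrite eq_sym.
    by rewrite sH; move: (all1 t tZ); rewrite ts.
  by move: (all1 r rZ); rewrite rs.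
rewrite negb_forall_in => /exists_inP[v vZ]; rewrite negb_imply => /andP[vs Hsv].
have all0 t : t \in Z -> t != s -> ~~ H s t.
  move=> tZ ts; case: (eqVneq t v) => [->//|tv].
  apply/negP => Hst; case: (boolP (H t v)) => [Htv|Htv].
    by move: Hsv; rewrite (Htr s t v) // eq_sym.
  have := Ctr s v t sZ vZ tZ; rewrite Hst /= => C; suff : false by [].
  by apply: C => //; rewrite ?(sH v) // eq_sym.
exists false => t r tZ rZ tr; apply: negbTE.
case: (eqVneq t s) => [ts|ts].
  by rewrite ts in tr *; apply: all0 => //; rewrite eq_sym.
case: (eqVneq r s) => [rs|rs]; first by rewrite rs sH all0.
apply: (Ctr t s r) => //; first by rewrite eq_sym.
  by rewrite sH all0.
exact: all0.
Qed.

Lemma bounded_co_connected :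
  (forall x y, connect (corel H) x y) -> (forall x y, connect H x y) ->
  #|U| < 2 ^ 8.
Proof.
move=> cC cH; rewrite ltnNge; apply/negP => U8.
have [g fK gK] := fbij.
have cK x y : connect K x y.
  by rewrite -(gK x) -(gK y); apply: connect_corel.
have HK x y : H x y = K x y.
  apply/idP/idP; last exact: no_long_hole.
  exact: (no_long_hole sK iH (no_holes_sym NH)).
have shareN x y b c : x != y -> ~~ H x y -> H x b -> H b y -> H x c -> H c y ->
    b = c.
  by rewrite !HK => xy nxy xb yb xc yc; apply: (no_C6 xy xc yc nxy); rewrite HK.
(* This is [shareN] for the images under [f]. *)
have shareC x y b c : H x y -> b != x -> b != y -> c != x -> c != y ->
    ~~ H x b -> ~~ H y b -> ~~ H x c -> ~~ H y c -> b = c.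
  move=> Hxy bx by_ cx cy xb yb xc yc; apply: finj; apply: (shareN (f x) (f y)).
  - by rewrite (inj_eq finj) neqH.
  - by rewrite HK fE /corel Hxy andbF.
  - by rewrite HK fE /corel eq_sym bx.
  - by rewrite HK fE /corel by_ sH.
  - by rewrite HK fE /corel eq_sym cx.
  - by rewrite HK fE /corel cy sH.
(* Ramsey gives one of the two sets and [f] maps it to the other kind; the exponent 8 is 4 + 4. *)
have [P [Q [cP cQ clP inQ]]] : exists P Q : {set U}, [/\ 4 <= #|P|, 4 <= #|Q|,
    {in P &, forall x y, x != y -> H x y} &
    {in Q &, forall x y, x != y -> ~~ H x y}].
  have [|[B cB [_ hB]]|[B cB [_ hB]]] := @ramsey H 4 4 setT sH.
  - by rewrite cardsT.
  - exists B, (f @: B); split=> //; first by rewrite card_imset.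
    move=> _ _ /imsetP[x xB ->] /imsetP[y yB ->]; rewrite (inj_eq finj) => xy.
    by rewrite HK fE /corel xy hB.
  - exists (f @: B), B; split=> //; first by rewrite card_imset.
    move=> _ _ /imsetP[x xB ->] /imsetP[y yB ->]; rewrite (inj_eq finj) => xy.
    by rewrite HK fE /corel xy hB.
have cPQ : #|P :&: Q| <= 1.
  apply/card_le1_eqP => x y; rewrite !inE => /andP[xP xQ] /andP[yP yQ].
  by case: (eqVneq x y) => [->//|xy]; case/negP: (inQ _ _ xQ yQ xy); apply: clP.
(* A clique and an independent set share at most one vertex, so three vertices remain on each
   side. *)
have /card_gt2P[a [b [c [[]]]]] : 2 < #|P :\: Q| by have := cardsID Q P; lia.
rewrite !inE => /andP[aQ aP] /andP[bQ bP] /andP[cQ' cP'] [ab bc ca].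
have /card_gt2P[p [q [r [[]]]]] : 2 < #|Q :\: P|.
  by have := cardsID P Q; rewrite setIC; lia.
rewrite !inE => /andP[pP pQ] /andP[qP qQ] /andP[rP rQ] [pq qr rp].
have neqPQ x y : x \in P -> y \in Q -> y \notin P -> y != x.
  by move=> xP _; apply: contraNneq => ->.
have N1 s : s \in Q -> s \notin P ->
    [&& ~~ [&& H s a, H s b & ~~ H s c], ~~ [&& H s b, H s c & ~~ H s a] &
        ~~ [&& H s c, H s a & ~~ H s b]].
  move=> sQ sP.
  have N x y z : x \in P -> y \in P -> z \in P -> x != y -> y != z -> z != x ->
      ~~ [&& H s x, H s y & ~~ H s z].
    move=> xP yP zP xy yz zx; apply/negP => /and3P[sx sy sz].
    move: xy; rewrite (shareN s z x y) ?eqxx ?(neqPQ z) //; apply: clP => //.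
    by rewrite eq_sym.
  by rewrite !N.
have N2 t : t \in P -> t \notin Q ->
    [&& ~~ [&& ~~ H p t, ~~ H q t & H r t], ~~ [&& ~~ H q t, ~~ H r t & H p t] &
        ~~ [&& ~~ H r t, ~~ H p t & H q t]].
  move=> tP tQ.
  have N x y z : x \in Q -> y \in Q -> z \in Q -> x \notin P -> y \notin P ->
      x != y -> y != z -> z != x -> ~~ [&& ~~ H x t, ~~ H y t & H z t].
    move=> xQ yQ zQ xP yP xy yz zx; apply/negP => /and3P[tx ty tz].
    have xz : x != z by rewrite eq_sym.
    have zy : z != y by rewrite eq_sym.
    by move: xy; rewrite (shareC z t x y) ?eqxx ?(neqPQ t) ?(sH t) // inQ.
  by rewrite !N.
have N3 s t : s \in Q -> t \in Q -> s != t ->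
    [&& ~~ [&& H s a, H s b, H t a & H t b], ~~ [&& H s b, H s c, H t b & H t c] &
        ~~ [&& H s c, H s a, H t c & H t a]].
  move=> sQ tQ st.
  have N x y : x != y -> ~~ [&& H s x, H s y, H t x & H t y].
    move=> xy; apply/negP => /and4P[sx sy tx ty].
    by move: xy; rewrite (shareN s t x y) ?eqxx ?inQ // sH.
  by rewrite !N.
have N4 x y : x \in P -> y \in P -> x != y ->
    [&& ~~ [&& ~~ H p x, ~~ H p y, ~~ H q x & ~~ H q y],
        ~~ [&& ~~ H q x, ~~ H q y, ~~ H r x & ~~ H r y] &
        ~~ [&& ~~ H r x, ~~ H r y, ~~ H p x & ~~ H p y]].
  move=> xP yP xy.
  have N s t : s \in Q -> t \in Q -> s \notin P -> t \notin P -> s != t ->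
      ~~ [&& ~~ H s x, ~~ H s y, ~~ H t x & ~~ H t y].
    move=> sQ tQ sP tP st; apply/negP => /and4P[sx sy tx ty].
    move: st; rewrite (shareC x y s t (clP _ _ xP yP xy)) ?eqxx //.
    - exact: neqPQ.
    - exact: neqPQ.
    - exact: neqPQ.
    - exact: neqPQ.
    - by rewrite sH.
    - by rewrite sH.
    - by rewrite sH.
    - by rewrite sH.
  by rewrite !N.
(* Consider the 3 by 3 adjacency matrix with rows [p], [q], [r] and columns [a], [b], [c]. Rows have
   0, 1 or 3 ones and at most one is full; columns have 0, 2 or 3 ones and at most one is empty. A
   full row allows at most 5 ones but forces 6; without one there are at most 3, against at least 4.
   The cases are enumerated. *)
move: (N1 p pQ pP) (N1 q qQ qP) (N1 r rQ rP) (N2 a aP aQ) (N2 b bP bQ)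
  (N2 c cP' cQ') (N3 p q pQ qQ pq) (N3 q r qQ rQ qr) (N3 r p rQ pQ rp)
  (N4 a b aP bP ab) (N4 b c bP cP' bc) (N4 c a cP' aP ca).
by case: (H p a); case: (H p b); case: (H p c); case: (H q a); case: (H q b);
  case: (H q c); case: (H r a); case: (H r b); case: (H r c).
Qed.

End Complementary.

Lemma complementary_pair_structure H K f : symmetric H -> symmetric K -> irreflexive H ->
  irreflexive K -> bijective f ->
  (forall x y, K (f x) (f y) = corel H x y) -> no_holes H K -> 2 ^ 8 <= #|U| ->
  multipartite_cluster H K \/ multipartite_cluster K H.
Proof.
move=> sH sK iH iK fbij fE NH U8.
have U8' : 8 <= #|U| by apply: leq_trans U8.
have [g fK gK] := fbij.
have gbij : bijective g by exists f.
have gE x y : H (g x) (g y) = corel K x y.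
  have := fE (g x) (g y); rewrite !gK /corel => ->; rewrite (inj_eq (bij_inj gbij)).
  by case: eqVneq => [->|]; rewrite ?iH ?negbK.
case: (boolP [exists x, exists y, ~~ connect (corel H) x y]) => [|cH].
  case/existsP=> x /existsP[y nxy]; left.
  exact: (co_disconnected_multipartite_cluster (f := f)) nxy.
case: (boolP [exists x, exists y, ~~ connect (corel K) x y]) => [|cK].
  case/existsP=> x /existsP[y nxy]; right.
  exact: (co_disconnected_multipartite_cluster (f := g)) (no_holes_sym NH) _ _ U8' nxy.
have conn R : ~~ [exists x, exists y, ~~ connect (corel R) x y] ->
    forall x y, connect (corel R) x y.
  move=> h x y; apply: contraNT h => nxy.
  by apply/existsP; exists x; apply/existsP; exists y.
suff : #|U| < 2 ^ 8 by rewrite ltnNge U8.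
apply: (bounded_co_connected (f := f) (K := K)) => // [|x y]; first exact: conn.
(* Connectedness of the complement of [K] is carried by [g] to [H]. *)
rewrite -(fK x) -(fK y).
exact: (connect_corel (f := g) gE (conn _ cK _ _)).
Qed.

End Pairs.

(** * Testing a partition *)

Section Partitions.

Variables (T : finType) (G : sgraph T).
Implicit Types (A : {set T}).

Definition matched A := forall v,
  #|[set u | adj G v u & (v \in A) != (u \in A)]| = 1.

(** A total function restricted to [A] replaces the isomorphism between subtypes, with the
    complement moved to the source. *)
Definition co_iso A (f : T -> T) :=
  [/\ {in A &, injective f}, f @: A = ~: A &
      {in A &, forall x y, adj G (f x) (f y) = (x != y) && ~~ adj G x y}].

Lemma edges_betweenC A (B : {set T}) : edges_between G A B = edges_between G B A.
Proof.
have sub (C D : {set T}) : edges_between G C D \subset edges_between G D C.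
  apply/subsetP=> e /imset2P[x y xC]; rewrite inE => /andP[yD xy] ->.
  by apply/imset2P; exists y x; rewrite ?inE ?xC 1?adj_sym // setUC.
by apply/eqP; rewrite eqEsubset !sub.
Qed.

Lemma card_edges_at A v : v \in A ->
  #|[set e in edges_between G A (~: A) | v \in e]| =
  #|[set u | adj G v u & (v \in A) != (u \in A)]|.
Proof.
move=> vA; rewrite -(card_in_imset (f := fun u => [set v; u])); last first.
  move=> u u'; rewrite !inE vA => /andP[vu nu] /andP[vu' nu'] e.
  have : u \in [set v; u'] by rewrite -e set22.
  rewrite !inE => /orP[/eqP uv|/eqP//].
  by rewrite uv vA in nu.
apply: eq_card => e; rewrite inE; apply/andP/imsetP.
  case=> /imset2P[x y xA]; rewrite !inE => /andP[yA xy] ->.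
  rewrite !inE => /orP[/eqP e1|/eqP e1].
    by exists y; rewrite e1 // inE xy xA (negbTE yA).
  by rewrite -e1 vA in yA.
case=> u; rewrite inE vA => /andP[vu nu] ->; split; last exact: set21.
by apply/imset2P; exists v u; rewrite ?inE ?vu ?andbT //; case: (u \in A) nu.
Qed.

Lemma perfect_matchingP A :
  perfect_matching (edges_between G A (~: A)) <-> matched A.
Proof.
suff e v : #|[set e in edges_between G A (~: A) | v \in e]| =
    #|[set u | adj G v u & (v \in A) != (u \in A)]|.
  by split=> h v; rewrite -(h v) e.
case: (boolP (v \in A)) => [vA|vA]; first by rewrite card_edges_at ?vA.
rewrite edges_betweenC -{2}(setCK A) card_edges_at ?inE //.
by apply: eq_card => u; rewrite !inE (negbTE vA); case: (u \in A).
Qed.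

Lemma comp_sub_PMP :
  comp_sub_PM G <-> exists A f, matched A /\ co_iso A f.
Proof.
split=> [[A [B [AB dAB [h [hbij hE]] M]]]|[A [f [M [finj fA fE]]]]].
  have eB : B = ~: A.
    apply/setP=> x; move/setP/(_ x): AB; rewrite !inE.
    have := disjoint_setI0 dAB => /setP/(_ x); rewrite !inE.
    by case: (x \in A); case: (x \in B).
  subst B.
  (* Outside [A] the value is an arbitrary default. *)
  pose f x := if insub x is Some u then val (h u) else x.
  have fv x (xA : x \in A) : f x = val (h (Sub x xA)) by rewrite /f insubT.
  exists A, f; split; first exact/perfect_matchingP.
  have finj : {in A &, injective f}.
    move=> x y xA yA; rewrite (fv _ xA) (fv _ yA) => /val_inj/(bij_inj hbij).
    by move/(congr1 val).
  split=> //; last first.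
    move=> x y xA yA; rewrite (fv _ xA) (fv _ yA).
    have := hE (Sub x xA) (Sub y yA).
    case: (eqVneq x y) => [exy|xy] /=.
      by subst y; rewrite (bool_irrelevance yA xA) !adj_irr.
    rewrite /compl_rel /= /induced_rel /= (inj_eq (bij_inj hbij)) -val_eqE /= xy /=.
    by move=> <-; rewrite negbK.
  apply/setP=> y; apply/imsetP/idP => [[x xA ->]|yA].
    by rewrite (fv _ xA); apply: valP.
  case: hbij => g hK gK; exists (val (g (Sub y yA))); first exact: valP.
  by rewrite /f valK gK.
exists A, (~: A); split; rewrite ?setUCr //; first by rewrite -setI_eq0 setICr.
  have fC x : x \in A -> f x \in ~: A by move=> xA; rewrite -fA imset_f.
  pose h (u : {x | x \in A}) : {x | x \in ~: A} := Sub (f (val u)) (fC _ (valP u)).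
  have hinj : injective h.
    by move=> u v [] /finj e; apply: val_inj; apply: e; apply: valP.
  exists h; split.
    apply: inj_card_bij => //; rewrite !card_sig.
    rewrite (eq_card (B := ~: A)) // (eq_card (A := [pred x | x \in A]) (B := A)) //.
    by rewrite -fA card_in_imset.
  move=> u v; rewrite /= /compl_rel /= /induced_rel /= (inj_eq hinj).
  rewrite fE ?(valP u) ?(valP v) //.
  by rewrite -val_eqE /=; case: eqVneq => [->|_]; rewrite ?adj_irr ?negbK.
exact/perfect_matchingP.
Qed.

Lemma matchedC A : matched A -> matched (~: A).
Proof.
move=> M v; rewrite -(M v); apply: eq_card => u; rewrite !inE.
by case: (v \in A); case: (u \in A).
Qed.

Lemma co_isoC A f : co_iso A f -> exists g, co_iso (~: A) g.
Proof.
move=> [finj fA fE]; pose g y := odflt y [pick x in A | f x == y].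
have gP y : y \in ~: A -> g y \in A /\ f (g y) = y.
  rewrite -fA => /imsetP[x xA ->]; rewrite /g; case: pickP => [z|/(_ x)] /=.
    by case/andP=> zA /eqP.
  by rewrite xA eqxx.
exists g; split.
- by move=> y z /gP[_ ey] /gP[_ ez] e; rewrite -ey -ez e.
- rewrite setCK; apply/setP=> x; apply/imsetP/idP => [[y yA ->]|xA].
    by case: (gP y yA).
  have fxA : f x \in ~: A by rewrite -fA imset_f.
  by exists (f x) => //; have [gA /finj->] := gP _ fxA.
- move=> y z yA zA; have [gy ey] := gP y yA; have [gz ez] := gP z zA.
  rewrite -{2 3}ey -{2 3}ez fE //.
  case: (eqVneq (g y) (g z)) => [->|ne]; first by rewrite adj_irr eqxx.
  by rewrite negbK (contra_neq _ ne) // => /finj ->.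
Qed.

Lemma card_co_iso A f : co_iso A f -> #|T| = 2 * #|A|.
Proof.
by move=> [finj fA _]; rewrite -(cardsC A) -fA card_in_imset // mul2n addnn.
Qed.

Definition mate A x := odflt x [pick y | adj G x y && ((x \in A) != (y \in A))].

Lemma mateP A x : matched A ->
  adj G x (mate A x) /\ (mate A x \in A) = (x \notin A).
Proof.
move=> M; rewrite /mate; case: pickP => [y /andP[xy]|n] /=.
  by case: (x \in A) (y \in A) => [] [].
have /eqP/cards1P[y /setP/(_ y)] := M x.
by rewrite !inE eqxx n.
Qed.

Lemma mate_unique A x y : matched A -> (y \in A) = (x \notin A) ->
  adj G x y = (y == mate A x).
Proof.
move=> M yA; have [xm mA] := mateP x M.
have /eqP/cards1P[z /setP ez] := M x.
have := ez y; have := ez (mate A x); rewrite !inE xm yA mA.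
by case: (x \in A) => /= /esym/eqP-> <-; rewrite andbT.
Qed.

Lemma mateK A : matched A -> involutive (mate A).
Proof.
move=> M x; have [xm mA] := mateP x M; apply/esym/eqP.
by rewrite -(mate_unique M) 1?adj_sym ?mA ?negbK.
Qed.

Definition multipartite_side A :=
  [/\ exists v w, [/\ v \in A, w \in A & adj G v w],
      {in A & &, forall x y z, ~~ adj G x y -> ~~ adj G y z -> ~~ adj G x z} &
      {in ~: A & &, forall x y z, adj G x y -> adj G y z -> x != z -> adj G x z}].

(** Both sides are viewed on the vertices of [A], through the matching. Since [A] is half of [T],
    the bound [2 ^ 9] leaves [2 ^ 8] vertices for [complementary_pair_structure]. *)
Lemma hole_free_sides A f : hole_free G -> matched A -> co_iso A f ->
  2 ^ 9 <= #|T| -> multipartite_side A \/ multipartite_side (~: A).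
Proof.
move=> hG M cf; rewrite (card_co_iso cf) expnS leq_mul2l /= => A8.
have [finj fA fE] := cf.
pose U := {x | x \in A}.
pose H : rel U := fun u v => adj G (val u) (val v).
pose K : rel U := fun u v => adj G (mate A (val u)) (mate A (val v)).
have fmA (u : U) : mate A (f (val u)) \in A.
  have : f (val u) \in ~: A by rewrite -fA imset_f // (valP u).
  by rewrite inE; have [_ ->] := mateP (f (val u)) M.
(* Following [f] by the matching gives a permutation of [A] that takes non-adjacency in [H] to
   adjacency in [K]. *)
pose F u : U := Sub (mate A (f (val u))) (fmA u).
have mA (u : U) : mate A (val u) \notin A.
  by have [_ ->] := mateP (val u) M; rewrite negbK (valP u).
have cross (u v : U) : adj G (val u) (mate A (val v)) = (u == v).
  rewrite (mate_unique M) ?(negbTE (mA v)) ?(valP u) //.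
  by rewrite (inj_eq (inv_inj (mateK M))) (inj_eq val_inj) eq_sym.
have NH : no_holes H K.
  move=> l k p q hp hq e0 e1 d.
  (* The cycle runs along [p] inside [A], crosses to the mate of [q k] at index [l + 1], and returns
     along the mates of [q] to that of [q 0]. *)
  pose c i := if i <= l then val (p i) else mate A (val (q (l + 1 + k - i))).
  suff : l + k + 2 < 5 by lia.
  apply: (@hole_freeP _ G _ c hG) => i j ij jk; rewrite /c.
  case: (leqP j l) => jl.
    rewrite (leq_trans (ltnW ij) jl); have [n e] := hp i j ij jl.
    split; first by rewrite (inj_eq val_inj).
    by rewrite [adj _ _ _]e; clear -ij jl; lia.
  case: (leqP i l) => il.
    split; first by apply: contraNneq (mA (q (l + 1 + k - j))) => <-; apply: valP.
    (* A crossing edge is a matching edge, so it occurs only where [p] and [q] meet, at a common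
       end. *)
    rewrite cross; apply/eqP/idP => [e|].
      have jk' : l + 1 + k - j <= k by clear -jl; lia.
      by have := d _ _ il jk' e; clear -jl jk il; lia.
    case/orP=> [/eqP ei|/andP[/eqP-> /eqP ej]].
      have -> : i = l by clear -ei il jl; lia.
      by rewrite e1; congr q; clear -ei il jl; lia.
    by rewrite e0; congr q; clear -ej; lia.
  have [||n e] := hq (l + 1 + k - j) (l + 1 + k - i).
  - by clear -ij jk il; lia.
  - by clear -il; lia.
  split; first by rewrite (inj_eq (inv_inj (mateK M))) (inj_eq val_inj) eq_sym.
  by rewrite adj_sym [adj _ _ _]e; clear -ij jk il; lia.
have [||||||||[[v [w Hvw]] Hco Ktr]|[[v [w Kvw]] Kco Htr]] :=
  @complementary_pair_structure U H K F.
- by move=> u v; rewrite /H adj_sym.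
- by move=> u v; rewrite /K adj_sym.
- by move=> u; rewrite /H adj_irr.
- by move=> u; rewrite /K adj_irr.
- apply: injF_bij => u v [] /(inv_inj (mateK M))/finj e; apply: val_inj.
  by apply: e; apply: valP.
- move=> u v; rewrite /K /= !mateK // fE ?(valP u) ?(valP v) //.
- exact: NH.
- by rewrite card_sig (eq_card (B := A)).
- left; split.
  + by exists (val v), (val w); split=> //; apply: valP.
  + move=> x y z xA yA zA.
    exact: (Hco (Sub x xA) (Sub y yA) (Sub z zA)).
  + have mC x : x \in ~: A -> mate A x \in A.
      by rewrite inE; have [_ ->] := mateP x M.
    move=> x y z /mC xA /mC yA /mC zA.
    have := Ktr (Sub (mate A x) xA) (Sub (mate A y) yA)
      (Sub (mate A z) zA).
    by rewrite /K -val_eqE /= !mateK // (inj_eq (inv_inj (mateK M))).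
- right; split.
  + exists (mate A (val v)), (mate A (val w)); split=> //; rewrite inE; exact: mA.
  + have mC x : x \in ~: A -> mate A x \in A.
      by rewrite inE; have [_ ->] := mateP x M.
    move=> x y z /mC xA /mC yA /mC zA.
    by have := Kco (Sub (mate A x) xA) (Sub (mate A y) yA)
      (Sub (mate A z) zA); rewrite /K /= !mateK.
  + rewrite setCK => x y z xA yA zA.
    by have := Htr (Sub x xA) (Sub y yA) (Sub z zA); rewrite -val_eqE.
Qed.

End Partitions.

(** * Bijections respecting an equivalence relation *)

Lemma exists_bij (T : finType) (A B : {set T}) : #|A| = #|B| ->
  exists h : T -> T, {in A &, injective h} /\ h @: A = B.
Proof.
move=> AB; case: (set_0Vmem B) => [B0|[y yB]].
  exists id; split; first by [].
  by rewrite imset_id B0; apply/eqP; rewrite -cards_eq0 AB B0 cards0.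
pose h x := nth y (enum B) (index x (enum A)).
have idx x : x \in A -> index x (enum A) < size (enum B).
  by move=> xA; rewrite -cardE -AB cardE index_mem mem_enum.
have hinj : {in A &, injective h}.
  move=> x z xA zA /eqP; rewrite nth_uniq ?enum_uniq ?idx // => /eqP e.
  by rewrite -(nth_index y (s := enum A) (x := x)) ?mem_enum // e nth_index ?mem_enum.
exists h; split=> //; apply/eqP; rewrite eqEcard card_in_imset // AB leqnn andbT.
by apply/subsetP=> _ /imsetP[x xA ->]; rewrite -mem_enum mem_nth ?idx.
Qed.

(** For unions of classes, counting the elements in classes of size [s] amounts to counting those
    classes. Two classes of equal size are matched and removed, and the induction goes on with the
    rest. *)
Lemma equivalence_matching (T : finType) (R : rel T) (X Y : {set T}) :
  reflexive R -> symmetric R -> transitive R ->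
  {in X, forall x y, R x y -> y \in X} -> {in Y, forall x y, R x y -> y \in Y} ->
  (forall s, #|[set x in X | #|[set z | R x z]| == s]| =
             #|[set y in Y | #|[set z | R y z]| == s]|) ->
  exists f : T -> T, [/\ {in X &, injective f}, f @: X = Y &
    {in X &, forall x y, R (f x) (f y) = R x y}].
Proof.
move=> rR sR tR; move: {2}#|X| (leqnn #|X|) => n.
elim: n X Y => [|n IH] X Y.
  rewrite leqn0 cards_eq0 => /eqP-> _ _ E; exists id; split.
  - by move=> x y; rewrite inE.
  - apply/esym/eqP; rewrite imset_id; apply/set0Pn => -[y yY].
    have := E #|[set z | R y z]|; rewrite [LHS]eq_card0; last by move=> z; rewrite !inE.
    by move/esym/eqP; rewrite cards_eq0 => /eqP/setP/(_ y); rewrite !inE yY eqxx.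
  - by move=> x y; rewrite inE.
case: (set_0Vmem X) => [->|[x xX]]; first by move=> _; apply: IH; rewrite cards0.
move=> Xn cX cY E.
have [y yY xy] : exists2 y, y \in Y & #|[set z | R y z]| = #|[set z | R x z]|.
  have : 0 < #|[set y in Y | #|[set z | R y z]| == #|[set z | R x z]|]|.
    by rewrite -E; apply/card_gt0P; exists x; rewrite inE xX eqxx.
  by case/card_gt0P=> y; rewrite inE => /andP[yY /eqP e]; exists y.
(* Removing the class of [u] lowers the count at its own size by that size and changes no other
   count. *)
have rest (Z : {set T}) u s : {in Z, forall x y, R x y -> y \in Z} -> u \in Z ->
    #|[set z in Z :\: [set z | R u z] | #|[set t | R z t]| == s]| =
    #|[set z in Z | #|[set t | R z t]| == s]| -
    (if #|[set z | R u z]| == s then #|[set z | R u z]| else 0).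
  move=> cZ uZ.
  have cls z : R u z -> #|[set t | R z t]| = #|[set t | R u t]|.
    move=> uz; apply: eq_card => t; rewrite !inE; apply/idP/idP; first exact: tR.
    by apply: tR; rewrite sR.
  rewrite (_ : [set z in Z :\: _ | _] =
    [set z in Z | #|[set t | R z t]| == s] :\: [set z | R u z]); last first.
    by apply/setP=> z; rewrite !inE andbA.
  rewrite cardsD; congr (_ - _); case: eqP => [es|es].
    apply: eq_card => z; rewrite !inE; case: (boolP (R u z)) => uz; rewrite ?andbF //.
    by rewrite (cZ u) // cls // es eqxx.
  apply/eqP; rewrite cards_eq0; apply/eqP/setP=> z; rewrite !inE.
  by case: (boolP (R u z)) => uz; rewrite ?andbF // cls //; case: eqP; rewrite ?andbF.
have clo (Z : {set T}) u : {in Z, forall x y, R x y -> y \in Z} ->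
    {in Z :\: [set z | R u z], forall x y, R x y -> y \in Z :\: [set z | R u z]}.
  move=> cZ v; rewrite !inE => /andP[uv vZ] w vw; rewrite !inE (cZ v) // andbT.
  by apply: contra uv => uw; apply: tR uw _; rewrite sR.
have [|||s|f [finj fX fR]] := IH (X :\: [set z | R x z]) (Y :\: [set z | R y z]).
- rewrite -ltnS; apply: leq_trans Xn; apply: proper_card.
  apply/properP; split; first exact: subsetDl.
  by exists x; rewrite // !inE rR.
- exact: clo.
- exact: clo.
- by rewrite !rest // E xy.
have [h [hinj hC]] := exists_bij (esym xy).
have hR z : R x z -> R y (h z).
  by move=> xz; have : h z \in [set z | R y z]; [rewrite -hC imset_f ?inE | rewrite inE].
have fY z : z \in X -> ~~ R x z -> f z \in Y /\ ~~ R y (f z).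
  move=> zX xz; have : f z \in Y :\: [set z | R y z].
    by rewrite -fX imset_f // !inE xz.
  by rewrite !inE => /andP[].
exists (fun z => if R x z then h z else f z); split.
- move=> z t zX tX; case: ifP => xz; case: ifP => xt e.
  + by apply: hinj; rewrite ?inE.
  + by have [_] := fY t tX (negbT xt); rewrite -e hR.
  + by have [_] := fY z zX (negbT xz); rewrite e hR.
  + by apply: finj; rewrite // !inE ?xz ?xt.
- apply/setP=> t; apply/imsetP/idP => [[z zX ->]|tY].
    case: ifP => xz; first by apply: (cY y) => //; apply: hR.
    by have [] := fY z zX (negbT xz).
  case: (boolP (R y t)) => yt.
    have : t \in h @: [set z | R x z] by rewrite hC inE.
    by case/imsetP=> z; rewrite inE => xz ->; exists z; [apply: (cX x) | rewrite xz].
  have : t \in f @: (X :\: [set z | R x z]) by rewrite fX !inE yt.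
  by case/imsetP=> z; rewrite !inE => /andP[xz zX] ->; exists z; rewrite ?(negbTE xz).
- move=> z t zX tX; case: ifP => xz; case: ifP => xt.
  + by rewrite (tR y) ?hR 1?sR ?hR // (tR x) // sR.
  + have [_ nt] := fY t tX (negbT xt).
    rewrite (_ : R z t = false); last by apply: contraFF xt; apply: tR.
    by apply: contraNF nt; apply: tR; apply: hR.
  + have [_ nz] := fY z zX (negbT xz).
    rewrite (_ : R z t = false); last first.
      by apply: contraFF xz => zt; apply: tR xt _; rewrite sR.
    by apply: contraNF nz => ft; apply: tR (hR _ xt) _; rewrite sR.
  + by rewrite fR // !inE ?xz ?xt.
Qed.

(** * The test for a single candidate and its correctness *)

Section Check.

Variables (T : finType) (G : sgraph T).
Implicit Types (A : {set T}).

(* Transitive exactly when [A] induces a complete multipartite graph and its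
   complement a disjoint union of cliques. *)
Definition part_rel A : rel T := fun x y =>
  ((x \in A) == (y \in A)) && ((x == y) || ((x \in A) != adj G x y)).

Definition part_size A x := #|[set z | part_rel A x z]|.

(** Comparing part sizes replaces the search for an isomorphism. Only sizes attained at some vertex
    are compared, as any other size counts zero on both sides. *)
Definition check A :=
  [&& [forall x, #|[set y | adj G x y & (x \in A) != (y \in A)]| == 1],
      [forall x, forall y, forall z,
        part_rel A x y && part_rel A y z ==> part_rel A x z] &
      [forall x, #|[set y | (y \in A) && (part_size A y == part_size A x)]| ==
                 #|[set y | (y \notin A) && (part_size A y == part_size A x)]|]].

Definition candidate v w v' w' :=
  [set x | (adj G v x || adj G w x) && ((x != v') && (x != w'))].

Lemma part_rel_refl A : reflexive (part_rel A).
Proof. by move=> x; rewrite /part_rel !eqxx. Qed.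

Lemma part_rel_sym A : symmetric (part_rel A).
Proof.
move=> x y; rewrite /part_rel [y == x]eq_sym adj_sym.
by case: (x \in A); case: (y \in A).
Qed.

(** A bijection from [A] to its complement that preserves [part_rel] exchanges adjacency and
    non-adjacency of distinct vertices, because [part_rel] reads adjacency oppositely on the two
    sides. *)
Lemma check_sound A : check A -> comp_sub_PM G.
Proof.
case/and3P=> /forallP M /forallP tr /forallP cnt; apply/comp_sub_PMP.
have [|||s|f [finj fA fR]] :=
    @equivalence_matching T (part_rel A) A (~: A) (@part_rel_refl A) (@part_rel_sym A).
- move=> y x z xy yz; apply: implyP (forallP (forallP (tr x) y) z) _.
  by rewrite xy.
- by move=> x xA y /andP[/eqP<-].
- by move=> x; rewrite inE => xA y /andP[/eqP e _]; rewrite inE -e.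
- case: (pickP (fun x => part_size A x == s)) => [x /eqP<-|n].
    apply: etrans (etrans _ (eqP (cnt x))) _; apply: eq_card => y;
      by rewrite !inE.
  by rewrite !eq_card0 // => y; rewrite !inE;
    move: (n y); rewrite /part_size => ->; rewrite andbF.
exists A, f; split; first by move=> v; apply/eqP.
split=> // x y xA yA; have fC z : z \in A -> (f z \in A) = false.
  by move=> zA; apply: negbTE; rewrite -in_setC -fA imset_f.
case: (eqVneq x y) => [->|xy] /=; first by rewrite adj_irr.
have := fR x y xA yA; rewrite /part_rel !fC // xA yA eqxx /= (negbTE xy) /=.
by rewrite (inj_in_eq finj) // (negbTE xy) /=; case: (adj G x y); case: (adj G (f x) _).
Qed.

Lemma check_complete A f : matched G A -> co_iso G A f -> multipartite_side G A ->
  exists v w v' w', check (candidate v w v' w').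
Proof.
move=> M [finj fA fE] [[v [w [vA wA vw]]] co tr].
exists v, w, (mate G A v), (mate G A w).
(* A vertex of [A] missed by both [v] and [w] would make them nonadjacent; outside [A] their only
   neighbours are their mates. *)
have -> : candidate v w (mate G A v) (mate G A w) = A.
  apply/setP=> x; rewrite inE; case: (boolP (x \in A)) => xA.
    have nm z : z \in A -> x != mate G A z.
      by move=> zA; apply: contraTneq xA => ->; have [_ ->] := mateP z M; rewrite zA.
    rewrite !nm // !andbT; apply: contraT; rewrite negb_or => /andP[vx wx].
    by move: (co v x w vA xA wA vx); rewrite (adj_sym G x) vw => /(_ wx).
  rewrite !(mate_unique M) ?vA ?wA ?(negbTE xA) //.
  by case: eqP; case: eqP.
apply/and3P; split.
- by apply/forallP=> x; rewrite M.
- apply/forallP=> x; apply/forallP=> y; apply/forallP=> z; apply/implyP.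
  rewrite /part_rel => /andP[/andP[/eqP xy h1] /andP[/eqP yz h2]].
  rewrite xy yz eqxx /=; rewrite xy yz in h1; rewrite yz in h2.
  case: (eqVneq x z) => //= xz.
  case/orP: h1 => [/eqP exy|h1]; first by move: h2; rewrite -exy (negbTE xz).
  case/orP: h2 => [/eqP eyz|h2]; first by move: h1; rewrite eyz.
  move: h1 h2; case: (boolP (z \in A)) => zA h1 h2.
    by apply: (co x y z); rewrite ?xy ?yz.
  have [xC yC zC] : [/\ x \in ~: A, y \in ~: A & z \in ~: A] by rewrite !inE xy yz.
  by rewrite (tr x y z) //; [case: (adj G x y) h1|case: (adj G y z) h2].
apply/forallP=> x; apply/eqP.
have fC z : z \in A -> (f z \in A) = false.
  by move=> zA; apply: negbTE; rewrite -in_setC -fA imset_f.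
(* As [f] complements adjacency it preserves [part_rel], hence part sizes and their counts. *)
have fR y z : y \in A -> z \in A -> part_rel A (f y) (f z) = part_rel A y z.
  move=> yA zA; rewrite /part_rel !fC // yA zA eqxx /= fE // (inj_in_eq finj) //.
  by case: (eqVneq y z) => //= _; case: (adj G y z).
have fS y : y \in A -> part_size A (f y) = part_size A y.
  move=> yA; rewrite /part_size -[RHS](card_in_imset (f := f)); last first.
    move=> s t; rewrite !inE => /andP[/eqP sA _] /andP[/eqP tA _].
    by apply: finj; [rewrite -sA | rewrite -tA].
  apply: eq_card => z; rewrite inE; apply/idP/imsetP => [h|[t]].
    have : z \in ~: A by case/andP: h => /eqP; rewrite fC // inE => <-.
    rewrite -fA => /imsetP[t tA ez]; exists t => //.
    by rewrite inE -fR // -ez.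
  rewrite inE => yt ->; rewrite fR //; by case/andP: yt => /eqP <-.
rewrite -(card_in_imset (f := f)); last first.
  by move=> s t; rewrite !inE => /andP[sA _] /andP[tA _]; apply: finj.
apply: eq_card => z; rewrite inE; apply/imsetP/idP => [[y]|/andP[zA zs]].
  by rewrite inE => /andP[yA ys] ->; rewrite fC // fS.
have : z \in ~: A by rewrite inE.
rewrite -fA => /imsetP[t tA ez]; exists t => //.
by rewrite inE tA -fS // -ez.
Qed.

(** If the complement of [A] is the multipartite side, the same partition is found with its sides
    exchanged. *)
Lemma checkP : hole_free G -> 2 ^ 9 <= #|T| ->
  comp_sub_PM G <-> exists v w v' w', check (candidate v w v' w').
Proof.
move=> hG T9; split; last by case=> v [w [v' [w' /check_sound]]].
case/comp_sub_PMP=> A [f [M cf]].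
have [mA|mA] := hole_free_sides hG M cf T9; first exact: check_complete M cf mA.
by have [g cg] := co_isoC cf; apply: check_complete (matchedC M) cg mA.
Qed.

End Check.

(** * The algorithm as an expression *)

Definition ENot a := EIf a (ECst 0) (ECst 1).
Definition EAnd a b := EIf a (EIf b (ECst 1) (ECst 0)) (ECst 0).
Definition EOr a b := EIf a (ECst 1) (EIf b (ECst 1) (ECst 0)).
Definition EEq a b := ENot (EAdd (ESub a b) (ESub b a)).
Definition ELt a b := EIf (ESub b a) (ECst 1) (ECst 0).

(* The number of vertices is the number of leading ones of the input. *)
Definition EOrder :=
  ESum 20 (ENot (ESum 21 (EAnd (ENot (ELt (EVar 20) (EVar 21)))
                               (ENot (ERead (EVar 21)))))).
Definition ESumV x e := ESum x (EIf (ELt (EVar x) EOrder) e (ECst 0)).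
Definition EAll x e := ENot (ESumV x (ENot e)).

(** The matrix starts at cell [n + 1]. The row offset, [n] times [x], is computed as a sum over the
    vertices, since expressions have no product. *)
Definition EAdj x y :=
  ERead (EAdd (EAdd EOrder (ECst 1)) (EAdd (ESumV 22 (EVar x)) (EVar y))).

(* Registers 1 to 4 hold the vertices [v], [w], [v'], [w'] of [candidate]. *)
Definition ECand x :=
  EAnd (EOr (EAdj 1 x) (EAdj 2 x))
       (EAnd (ENot (EEq (EVar x) (EVar 3))) (ENot (EEq (EVar x) (EVar 4)))).

Definition EPart x y :=
  EAnd (EEq (ECand x) (ECand y))
       (EOr (EEq (EVar x) (EVar y)) (ENot (EEq (ECand x) (EAdj x y)))).

Definition EPartSize x := ESumV 7 (EPart x 7).

Definition ECheck :=
  EAnd (EAll 5 (EEq (ESumV 6 (EAnd (EAdj 5 6) (ENot (EEq (ECand 5) (ECand 6)))))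
                    (ECst 1)))
 (EAnd (EAll 5 (EAll 6 (EAll 7
          (EOr (ENot (EAnd (EPart 5 6) (EPart 6 7))) (EPart 5 7)))))
       (EAll 5 (EEq
          (ESumV 6 (EAnd (ECand 6) (EEq (EPartSize 6) (EPartSize 5))))
          (ESumV 6 (EAnd (ENot (ECand 6)) (EEq (EPartSize 6) (EPartSize 5))))))).

Definition ESearch := ESumV 1 (ESumV 2 (ESumV 3 (ESumV 4 ECheck))).

Lemma eq_nat_of_bool (a b : bool) : (a == b :> nat) = (a == b).
Proof. by case: a; case: b. Qed.

Lemma sum_nat_of_bool (T : finType) (P : pred T) :
  \sum_i (P i : nat) = #|[set i | P i]|.
Proof. by rewrite -sum1dep_card [RHS]big_mkcond; apply: eq_bigr => i _; case: (P i). Qed.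

Section Boolean.

Variables (m rho : nat -> nat).

Lemma eval_var x : eval m rho (EVar x) = rho x. Proof. by []. Qed.

Lemma eval_cst k : eval m rho (ECst k) = k. Proof. by []. Qed.

Lemma eval_add a b : eval m rho (EAdd a b) = eval m rho a + eval m rho b.
Proof. by []. Qed.

Lemma eval_read a : eval m rho (ERead a) = m (eval m rho a). Proof. by []. Qed.

Lemma eval_if a b c : eval m rho (EIf a b c) =
  if eval m rho a != 0 then eval m rho b else eval m rho c.
Proof. by []. Qed.

Lemma eval_sum x a :
  eval m rho (ESum x a) = \sum_(i < rho 0) eval m (upd rho x i) a.
Proof. by []. Qed.

Lemma eval_not a : eval m rho (ENot a) = (eval m rho a == 0) :> nat.
Proof. by rewrite /=; case: eqP. Qed.

Lemma eval_and a b :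
  eval m rho (EAnd a b) = (eval m rho a != 0) && (eval m rho b != 0) :> nat.
Proof. by rewrite /=; case: eqP => //= _; case: eqP. Qed.

Lemma eval_or a b :
  eval m rho (EOr a b) = (eval m rho a != 0) || (eval m rho b != 0) :> nat.
Proof. by rewrite /=; case: eqP => //= _; case: eqP. Qed.

Lemma eval_eq a b : eval m rho (EEq a b) = (eval m rho a == eval m rho b) :> nat.
Proof. by rewrite eval_not /= addn_eq0 !subn_eq0 -eqn_leq. Qed.

Lemma eval_neq a b :
  eval m rho (ENot (EEq a b)) = (eval m rho a != eval m rho b) :> nat.
Proof. by rewrite eval_not eval_eq eqb0. Qed.

Lemma eval_lt a b : eval m rho (ELt a b) = (eval m rho a < eval m rho b) :> nat.
Proof. by rewrite /= subn_eq0 -ltnNge; case: ltnP. Qed.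

End Boolean.

Arguments eval : simpl never.

Lemma nth_allpairs (S T R : Type) (x0 : S) (y0 : T) (z0 : R) (f : S -> T -> R) s t i j :
  i < size s -> j < size t ->
  nth z0 [seq f x y | x <- s, y <- t] (i * size t + j) = f (nth x0 s i) (nth y0 t j).
Proof.
elim: s i => // x s IH [|i] /= il jl; rewrite nth_cat size_map.
  by rewrite jl (nth_map y0).
by rewrite ifN ?mulSn -?addnA ?addKn ?IH // -leqNgt leq_addr.
Qed.

Section Encoding.

Variables (n : nat) (G : sgraph 'I_n).

Lemma size_encode : size (encode G) = n + (n * n).+1.
Proof. by rewrite size_cat size_nseq /= size_allpairs size_enum_ord. Qed.

Lemma nth_encode_lt i : i < n -> nth false (encode G) i.
Proof. by move=> il; rewrite nth_cat size_nseq il nth_nseq il. Qed.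

Lemma nth_encode_n : nth false (encode G) n = false.
Proof. by rewrite nth_cat size_nseq ltnn subnn. Qed.

Lemma nth_encode_adj (i j : 'I_n) :
  nth false (encode G) (n + 1 + (n * i + j)) = adj G i j.
Proof.
rewrite nth_cat size_nseq ifN; last by rewrite -leqNgt -addnA leq_addr.
rewrite -addnA addKn add1n /= mulnC.
have := @nth_allpairs _ _ _ i i false (adj G) (enum 'I_n) (enum 'I_n) i j.
by rewrite size_enum_ord !nth_ord_enum => ->.
Qed.

Let m := Defs.mem (init (encode G)).
Let L := size (encode G).

Let mE a : m a = nth false (encode G) a.
Proof. by []. Qed.

Let le_n_L : n <= L. Proof. by rewrite /L size_encode leq_addr. Qed.

(** A position [i] counts one when no cell up to [i] is zero; the first zero is the separator in
    cell [n]. *)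
Lemma eval_order rho : rho 0 = L -> eval m rho EOrder = n.
Proof.
move=> rho0; rewrite eval_sum rho0.
rewrite (eq_bigr (fun i : 'I_L => if i < n then 1 else 0)); last first.
  move=> i _; rewrite eval_not eval_sum -[upd rho 20 i 0]/(rho 0) rho0 sum_nat_eq0.
  transitivity (nat_of_bool (i < n)); last by case: ltnP.
  congr nat_of_bool; apply/forallP/idP => [h|il j]; last first.
    rewrite /= eval_and !eval_not eval_lt eval_read !eval_var /upd /= mE !eqb0 negbK.
    by case: ltnP => // ji; rewrite nth_encode_lt // (leq_ltn_trans ji).
  rewrite ltnNge; apply/negP => il.
  have nL : n < L by rewrite /L size_encode; lia.
  have := h (Ordinal nL).
  rewrite /= eval_and !eval_not eval_lt eval_read !eval_var /upd /= mE nth_encode_n.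
  by rewrite ltnNge il.
by rewrite -big_mkcond -(big_ord_widen L (fun=> 1) le_n_L) sum1_card card_ord.
Qed.

Lemma eval_sumV rho x e : 0 < x -> rho 0 = L ->
  eval m rho (ESumV x e) = \sum_(i < n) eval m (upd rho x i) e.
Proof.
move=> x0 rho0; rewrite eval_sum rho0.
rewrite (big_ord_widen L (fun i => eval m (upd rho x i) e) le_n_L) [RHS]big_mkcond.
apply: eq_bigr => i _; rewrite eval_if eval_lt eval_order ?eval_var; last first.
  by rewrite /upd ltn_eqF.
by rewrite {1}/upd eqxx eqb0 negbK.
Qed.

Lemma eval_all rho x e : 0 < x -> rho 0 = L ->
  eval m rho (EAll x e) = [forall i : 'I_n, eval m (upd rho x i) e != 0] :> nat.
Proof.
move=> x0 rho0; rewrite eval_not eval_sumV // sum_nat_eq0; congr nat_of_bool.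
by apply: eq_forallb => i; rewrite /= eval_not eqb0.
Qed.

Lemma eval_adj rho x y (i j : 'I_n) : x != 22 -> rho 0 = L -> rho x = i -> rho y = j ->
  eval m rho (EAdj x y) = adj G i j.
Proof.
move=> x22 rho0 rx ry.
rewrite eval_read mE !eval_add eval_order // eval_sumV //.
rewrite (eq_bigr (fun=> i : nat)); last first.
  by move=> k _; rewrite eval_var /upd (negbTE x22).
by rewrite sum_nat_const card_ord eval_var ry nth_encode_adj.
Qed.

Section Candidate.

Variables v w v' w' : 'I_n.

Let A := candidate G v w v' w'.

Let good (rho : nat -> nat) :=
  [/\ rho 0 = L, rho 1 = v, rho 2 = w, rho 3 = v' & rho 4 = w'].

Let good0 rho : good rho -> rho 0 = L. Proof. by case. Qed.

Let good_upd rho x i : 4 < x -> good rho -> good (upd rho x i).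
Proof. by case: x => [|[|[|[|[|x]]]]] // _; case. Qed.

Lemma eval_cand rho x (i : 'I_n) : x != 22 -> good rho -> rho x = i ->
  eval m rho (ECand x) = (i \in A).
Proof.
move=> x22 [r0 r1 r2 r3 r4] rx.
rewrite eval_and eval_or (eval_adj (i := v) (j := i)) // (eval_adj (i := w) (j := i)) //.
rewrite eval_and !eval_neq !eval_var rx r3 r4.
by rewrite inE !eqb0 !negbK.
Qed.

Lemma eval_part rho x y (i j : 'I_n) : x != 22 -> y != 22 -> good rho ->
  rho x = i -> rho y = j -> eval m rho (EPart x y) = part_rel G A i j.
Proof.
move=> x22 y22 gr rx ry; have r0 := good0 gr.
rewrite eval_and eval_or eval_neq !eval_eq !eval_var rx ry.
rewrite (eval_cand _ gr rx) // (eval_cand _ gr ry) // (eval_adj _ r0 rx ry) //.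
by rewrite !eqb0 !negbK /part_rel !eq_nat_of_bool.
Qed.

Lemma eval_part_size rho x (i : 'I_n) : x != 22 -> x != 7 -> good rho ->
  rho x = i -> eval m rho (EPartSize x) = part_size G A i.
Proof.
move=> x22 x7 gr rx; rewrite eval_sumV ?(good0 gr) //.
rewrite /part_size -sum_nat_of_bool; apply: eq_bigr => k _.
have g7 : good (upd rho 7 k) by apply: good_upd.
have r7 : upd rho 7 k x = i by rewrite /upd (negbTE x7).
by rewrite (eval_part _ _ g7 r7 (erefl : upd rho 7 k 7 = k)).
Qed.

Lemma eval_check rho : good rho -> eval m rho ECheck = check G A.
Proof.
move=> gr; have r0 := good0 gr; rewrite !eval_and !eval_all // !eqb0 !negbK /check.
congr (nat_of_bool [&& _, _ & _]); apply: eq_forallb => i.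
- have g5 : good (upd rho 5 i) by apply: good_upd.
  rewrite eval_eq eval_cst eqb0 negbK eval_sumV //; congr (_ == _).
  rewrite -sum_nat_of_bool; apply: eq_bigr => j _.
  have g6 : good (upd (upd rho 5 i) 6 j) by apply: good_upd.
  rewrite eval_and eval_neq (eval_adj (i := i) (j := j)) //.
  rewrite (eval_cand (i := i)) // (eval_cand (i := j)) //.
  by rewrite eq_nat_of_bool !eqb0 !negbK.
- have g5 : good (upd rho 5 i) by apply: good_upd.
  rewrite eval_all // eqb0 negbK; apply: eq_forallb => j.
  have g6 : good (upd (upd rho 5 i) 6 j) by apply: good_upd.
  rewrite eval_all // eqb0 negbK; apply: eq_forallb => k.
  have g7 : good (upd (upd (upd rho 5 i) 6 j) 7 k) by apply: good_upd.
  rewrite eval_or eval_not eval_and (eval_part (i := i) (j := j)) //.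
  rewrite (eval_part (i := j) (j := k)) // (eval_part (i := i) (j := k)) //.
  by rewrite !eqb0 !negbK implybE.
- have g5 : good (upd rho 5 i) by apply: good_upd.
  rewrite eval_eq !eval_sumV // eqb0 negbK -!sum_nat_of_bool.
  congr (_ == _); apply: eq_bigr => j _;
    have g6 : good (upd (upd rho 5 i) 6 j) by apply: good_upd.
    rewrite eval_and eval_eq (eval_cand (i := j)) //.
    rewrite (eval_part_size (i := j)) // (eval_part_size (i := i)) //.
    by rewrite !eqb0 !negbK.
  rewrite eval_and eval_eq eval_not (eval_cand (i := j)) //.
  rewrite (eval_part_size (i := j)) // (eval_part_size (i := i)) //.
  by rewrite !eqb0 !negbK.
Qed.

End Candidate.

Lemma eval_search rho : rho 0 = L ->
  (eval m rho ESearch != 0) <-> exists v w v' w', check G (candidate G v w v' w').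
Proof.
move=> r0; rewrite eval_sumV // sum_nat_eq0; split.
  move/forallPn=> [v]; rewrite eval_sumV // sum_nat_eq0 => /forallPn[w].
  rewrite eval_sumV // sum_nat_eq0 => /forallPn[v'].
  rewrite eval_sumV // sum_nat_eq0 => /forallPn[w'].
  rewrite (eval_check (v := v) (w := w) (v' := v') (w' := w')) // eqb0 negbK.
  by move=> h; exists v, w, v', w'.
case=> v [w [v' [w' h]]].
apply/forallPn; exists v; rewrite eval_sumV // sum_nat_eq0.
apply/forallPn; exists w; rewrite eval_sumV // sum_nat_eq0.
apply/forallPn; exists v'; rewrite eval_sumV // sum_nat_eq0.
apply/forallPn; exists w'.
by rewrite (eval_check (v := v) (w := w) (v' := v') (w' := w')) // h.
Qed.

End Encoding.

(** * Tables for inputs of bounded length *)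

Lemma comp_sub_PM_encode n n' (G : sgraph 'I_n) (G' : sgraph 'I_n') :
  encode G = encode G' -> comp_sub_PM G -> comp_sub_PM G'.
Proof.
(* The length [n + n ^ 2 + 1] of a code determines [n]. *)
move=> e; have en : n = n'.
  by move/(congr1 size): (e); rewrite !size_encode; clear; nia.
subst n'; have adjE i j : adj G i j = adj G' i j by rewrite -!nth_encode_adj e.
case/comp_sub_PMP=> A [f [M [finj fA fE]]]; apply/comp_sub_PMP.
exists A, f; split; last by split=> // x y xA yA; rewrite -!adjE fE.
by move=> v; rewrite -(M v); apply: eq_card => u; rewrite !inE adjE.
Qed.

(** A decision tree that reads the word from its last bit; at each leaf excluded middle chooses the
    answer. *)
Lemma fixed_length_table (P : seq bool -> Prop) k : exists e, wf 1 e /\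
  forall m rho w, size w = k -> (forall i, i < k -> m i = nth false w i) ->
    (eval m rho e != 0) <-> P w.
Proof.
elim: k P => [|k IH] P.
  have [p|p] := classic (P [::]); [exists (ECst 1) | exists (ECst 0)];
    by split=> // m rho w /size0nil->.
have [e1 [w1 h1]] := IH (fun w => P (rcons w true)).
have [e0 [w0 h0]] := IH (fun w => P (rcons w false)).
exists (EIf (ERead (ECst k)) e1 e0); split; first by rewrite /= w1.
move=> m rho w; case/lastP: w => // w b; rewrite size_rcons => -[sw] mw.
have mw' i : i < k -> m i = nth false w i.
  by move=> ik; rewrite mw ?nth_rcons ?sw ?ik // ltnW.
rewrite eval_if eval_read eval_cst mw // nth_rcons sw ltnn eqxx.
by case: b {mw}; [apply: h1 | apply: h0].
Qed.

Lemma bounded_length_table (P : seq bool -> Prop) k : exists e, wf 1 e /\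
  forall w, size w <= k ->
    (eval (Defs.mem (init w)) (reg (init w)) e != 0) <-> P w.
Proof.
elim: k => [|k [e [we he]]].
  have [e [we he]] := fixed_length_table P 0; exists e; split=> // w.
  by rewrite leqn0 => /eqP sw; apply: he.
have [e' [we' he']] := fixed_length_table P k.+1.
exists (EIf (ESub (EVar 0) (ECst k)) e' e); split; first by rewrite /= we'.
move=> w sw; rewrite eval_if -[eval _ _ (ESub _ _)]/(size w - k) subn_eq0.
case: leqP => /= h; first exact: he.
by apply: he' => //; lia.
Qed.

Theorem theorem2 : solvable_in_poly_time_on hole_free comp_sub_PM.
Proof.
(* The table needs a property of words; [comp_sub_PM_encode] makes it agree with the property of the
   encoded graph. *)
pose P w := exists n (G : sgraph 'I_n), encode G = w /\ comp_sub_PM G.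
have [e [we he]] := bounded_length_table P (2 ^ 9 + (2 ^ 9 * 2 ^ 9).+1).
(* The variables in use are at most 22, so the result goes to register 23. Graphs with fewer than
   [2 ^ 9] vertices are left to the table. *)
apply: (@solvable_of_expr _ _ (EIf (ELt EOrder (ECst (2 ^ 9))) e ESearch) 23) => //.
  by rewrite /= (wf_leq _ we).
move=> n G hG; rewrite eval_if eval_lt eval_order // eval_cst eqb0 negbK.
case: ltnP => n9; last first.
  apply: (iff_trans (eval_search _)) => //; apply: iff_sym.
  by apply: checkP; rewrite // card_ord.
apply: (iff_trans (he _ _)).
  rewrite size_encode; apply: leq_add; first exact: ltnW.
  by rewrite ltnS; apply: leq_mul; apply: ltnW.
split=> [[n' [G' [eG]]]|pG]; first exact: comp_sub_PM_encode.
by exists n, G.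
Qed.
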